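(* Let $\mathcal{H}$ be a separable Hilbert space, $m\in\mathbb{N}$, and let $M$ be a densely defined, closed linear operator in $\mathcal{H}^m$ which is Fredholm. Let $\{T_\Lambda\}_{\Lambda\in\mathbb{N}}$ and $\{S_\Lambda^*\}_{\Lambda\in\mathbb{N}}$ be sequences in $\mathcal{B}(\mathcal{H})$, both converging strongly to $I_{\mathcal{H}}$ as $\Lambda\to\infty$, and put $S_\Lambda:=S_\Lambda^{**}$. Assume that for each $\Lambda\in\mathbb{N}$ there exists $\delta_\Lambda>0$ with $\Omega_\Lambda:=B(0,\delta_\Lambda)\setminus\{0\}\subseteq\rho(-MM^* )\cap\rho(-M^*M)$ such that the map $\Omega_\Lambda\ni z\mapsto T_\Lambda B_M(z)S_\Lambda$ takes values in $\mathcal{B}_1(\mathcal{H})$ and $$\Omega_\Lambda\ni z\mapsto \operatorname{tr}_{\mathcal{H}}(|T_\Lambda B_M(z)S_\Lambda|)=\|T_\Lambda B_M(z)S_\Lambda\|_{\mathcal{B}_1(\mathcal{H})}$$ is bounded (with respect to $z$). Then $$\operatorname{ind}(M)=\lim_{\Lambda\to\infty}\lim_{z\to 0}\operatorname{tr}_{\mathcal{H}}(T_\Lambda B_M(z)S_\Lambda).$$ If, in addition, $\delta:=\frac12\inf_{\Lambda\in\mathbb{N}}\delta_\Lambda>0$ and the functions $z\mapsto\operatorname{tr}_{\mathcal{H}}(T_\Lambda B_M(z)S_\Lambda)$ (extended to $z=0$ by their limits) converge uniformly on $\overline{B(0,\delta)}$ to some function $F$ as $\Lambda\to\infty$, then the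 limits $\Lambda\to\infty$ and $z\to 0$ in the preceding formula can be interchanged and $$F(0)=\operatorname{ind}(M).$$
   Context: For $T\in\mathcal{B}(\mathcal{H}^m)$ let $\iota_j:\mathcal{H}\to\mathcal{H}^m$ be the embedding into the $j$th component and $T_{jk}=\iota_j^*T\iota_k$; the internal trace of $T$ is the operator $\operatorname{tr}_m(T)=\sum_{j=1}^m T_{jj}\in\mathcal{B}(\mathcal{H})$. For a densely defined closed operator $M$ in $\mathcal{H}^m$ put $$B_M(z)=z\operatorname{tr}_m\big((M^*M+z)^{-1}-(MM^*+z)^{-1}\big),\qquad z\in\rho(-M^*M)\cap\rho(-MM^* ).$$ $\mathcal{B}_1(\mathcal{H})$ is the trace class, $\operatorname{tr}_{\mathcal{H}}$ the trace on it. $B(0,\delta)\subset\mathbb{C}$ is the open disc. A densely defined closed operator $M$ is Fredholm if its range is closed and $\ker M,\ker M^*$ are finite-dimensional; $\operatorname{ind}(M)=\dim\ker M-\dim\ker M^*$. *)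

(* Defs.v *)
From HB Require Import structures.
From mathcomp Require Import all_boot all_order all_algebra.
From mathcomp Require Import complex.
From mathcomp Require Import all_classical all_reals all_analysis.

Set Implicit Arguments.
Unset Strict Implicit.
Unset Printing Implicit Defensive.

Import Order.TTheory GRing.Theory Num.Theory.
Import numFieldNormedType.Exports.

Local Open Scope classical_set_scope.
Local Open Scope ring_scope.
Local Open Scope complex_scope.

(* mathcomp-analysis topologizes abstract numFieldTypes; this makes the norm
   topology canonical on the concrete type R[i]. *)
HB.instance Definition _ (R : realType) := NormedModule.copy R[i] (R[i]^o).

(* Inner products are linear in the first and conjugate-linear in the second
   argument. Norms of a normedModType R[i] take (real, nonnegative) values in
   R[i]. *)
HB.mixin Record hasInner (R : realType) V & NormedModule R[i] V := {
  inner : V -> V -> R[i];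
  inner_linearl : forall a x y z,
    inner (a *: x + y) z = a * inner x z + inner y z;
  inner_conj : forall x y, inner y x = Num.conj (inner x y);
  inner_norm : forall x, inner x x = `|x| ^+ 2
}.

#[short(type="preHilbertType")]
HB.structure Definition PreHilbert (R : realType) :=
  {V of NormedModule R[i] V & hasInner R V}.

#[short(type="hilbertType")]
HB.structure Definition Hilbert (R : realType) :=
  {V of PreHilbert R V & Complete V}.

HB.factory Record Lmodule_isPreHilbert (R : realType) V
    & GRing.Lmodule R[i] V := {
  inner : V -> V -> R[i];
  inner_linearl : forall a x y z,
    inner (a *: x + y) z = a * inner x z + inner y z;
  inner_conj : forall x y, inner y x = Num.conj (inner x y);
  inner_ge0 : forall x, 0 <= inner x x;
  inner_eq0 : forall x, inner x x = 0 -> x = 0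
}.

HB.builders Context R V & Lmodule_isPreHilbert R V.

Let nrm (x : V) : R[i] := sqrtC (inner x x).

Let nrmK x : nrm x ^+ 2 = inner x x. Proof. exact: sqrtCK. Qed.

Let nrm_ge0 x : 0 <= nrm x. Proof. by rewrite /nrm sqrtC_ge0 inner_ge0. Qed.

Let innerDl x y z : inner (x + y) z = inner x z + inner y z.
Proof. by rewrite -[x]scale1r inner_linearl mul1r scale1r. Qed.

Let inner0l z : inner 0 z = 0.
Proof. by apply: (addrI (inner 0 z)); rewrite -innerDl !addr0. Qed.

Let innerZl a x z : inner (a *: x) z = a * inner x z.
Proof. by rewrite -[a *: x]addr0 inner_linearl inner0l addr0. Qed.

Let innerDr x y z : inner z (x + y) = inner z x + inner z y.
Proof. by rewrite inner_conj innerDl rmorphD /= -!inner_conj. Qed.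

Let innerZr a x z : inner z (a *: x) = Num.conj a * inner z x.
Proof. by rewrite inner_conj innerZl rmorphM /= -inner_conj. Qed.

Let CauchySchwarz x y : `|inner x y| <= nrm x * nrm y.
Proof.
rewrite -(@ler_pXn2r _ 2) ?nnegrE ?mulr_ge0//.
rewrite exprMn !nrmK normCK -inner_conj.
have [y0|y0] := eqVneq (inner y y) 0.
  by rewrite (inner_eq0 y0) !inner0l !mulr0.
have yp : 0 < inner y y by rewrite lt0r y0 inner_ge0.
pose a := - (inner x y / inner y y).
have := inner_ge0 (x + a *: y).
rewrite innerDl !innerDr !innerZl !innerZr.
have -> : a * (Num.conj a * inner y y) = - (Num.conj a * inner x y).
  by rewrite mulrCA /a mulNr divfK// mulrN.
rewrite addrACA subrr addr0 /a mulNr subr_ge0 mulrAC ler_pdivrMr//.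
Qed.

Let nrmD x y : nrm (x + y) <= nrm x + nrm y.
Proof.
rewrite -(@ler_pXn2r _ 2) ?nnegrE ?addr_ge0//.
rewrite sqrrD !nrmK innerDl !innerDr addrA.
rewrite lerD2r -addrA lerD2l (inner_conj x y).
have Rr : inner x y + (inner x y)^* \is Num.real.
  by rewrite CrealE rmorphD /= conjCK addrC.
rewrite (le_trans (real_ler_norm Rr))// (le_trans (ler_normD _ _))//.
by rewrite norm_conjC -mulr2n lerMn2r CauchySchwarz orbT.
Qed.

Let nrmZ a x : nrm (a *: x) = `|a| * nrm x.
Proof.
apply/eqP; rewrite -(@eqrXn2 _ 2) ?mulr_ge0//.
by rewrite exprMn !nrmK innerZl innerZr mulrA normCK.
Qed.

Let nrm0_eq0 x : nrm x = 0 -> x = 0.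
Proof. by move=> x0; apply: inner_eq0; rewrite -nrmK x0 expr0n. Qed.
HB.instance Definition _ := @Lmodule_isNormed.Build R[i] V nrm nrmD nrmZ nrm0_eq0.

Let inner_nrm x : inner x x = `|x| ^+ 2. Proof. by rewrite -nrmK. Qed.

HB.instance Definition _ :=
  hasInner.Build R V inner_linearl inner_conj inner_nrm.

HB.end.

Section innerTheory.
Variables (R : realType) (V : preHilbertType R).
Implicit Types x y z : V.

Lemma innerDl x y z : inner (x + y) z = inner x z + inner y z.
Proof. by rewrite -[x]scale1r inner_linearl mul1r scale1r. Qed.

Lemma inner0l z : inner 0 z = 0.
Proof. by apply: (addrI (inner 0 z)); rewrite -innerDl !addr0. Qed.

Lemma innerZl a x z : inner (a *: x) z = a * inner x z.
Proof. by rewrite -[a *: x]addr0 inner_linearl inner0l addr0. Qed.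

Lemma innerDr x y z : inner z (x + y) = inner z x + inner z y.
Proof. by rewrite inner_conj innerDl rmorphD /= -!inner_conj. Qed.

Lemma inner0r z : inner z 0 = 0.
Proof. by rewrite inner_conj inner0l rmorph0. Qed.

Lemma innerZr a x z : inner z (a *: x) = Num.conj a * inner z x.
Proof. by rewrite inner_conj innerZl rmorphM /= -inner_conj. Qed.

End innerTheory.

(* A separate name, so that the instances below (inner product, Euclidean norm)
   are those of the orthogonal direct sum of m copies of H. *)
Definition hpow (H : Type) (m : nat) : Type := {ffun 'I_m -> H}.

Section hpow_inner.
Variables (R : realType) (H : preHilbertType R) (m : nat).

HB.instance Definition _ := GRing.Lmodule.copy (hpow H m) {ffun 'I_m -> H}.

Let hpow_inner (x y : hpow H m) : R[i] := \sum_(j < m) inner (x j) (y j).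

Let hpow_inner_linearl a (x y z : hpow H m) :
  hpow_inner (a *: x + y) z = a * hpow_inner x z + hpow_inner y z.
Proof.
rewrite /hpow_inner mulr_sumr -big_split; apply: eq_bigr => j _.
by rewrite !ffunE inner_linearl.
Qed.

Let hpow_inner_conj (x y : hpow H m) :
  hpow_inner y x = Num.conj (hpow_inner x y).
Proof. by rewrite rmorph_sum; apply: eq_bigr => j _; exact: inner_conj. Qed.

Let hpow_inner_ge0 (x : hpow H m) : 0 <= hpow_inner x x.
Proof. by apply: sumr_ge0 => j _; rewrite inner_norm exprn_ge0. Qed.

Let hpow_inner_eq0 (x : hpow H m) : hpow_inner x x = 0 -> x = 0.
Proof.
move/eqP; rewrite psumr_eq0; last by move=> j _; rewrite inner_norm exprn_ge0.
move=> /allP x0; apply/ffunP => j; rewrite ffunE; apply/eqP.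
by have := x0 j (mem_index_enum j); rewrite inner_norm sqrf_eq0 normr_eq0.
Qed.

HB.instance Definition _ := Lmodule_isPreHilbert.Build R (hpow H m)
  hpow_inner_linearl hpow_inner_conj hpow_inner_ge0 hpow_inner_eq0.

Lemma hpow_innerE (x y : hpow H m) : inner x y = \sum_(j < m) inner (x j) (y j).
Proof. by []. Qed.

Definition iota_hpow (j : 'I_m) (h : H) : hpow H m :=
  [ffun k => if k == j then h else 0].

Lemma inner_iota_hpow j h (y : hpow H m) : inner (iota_hpow j h) y = inner h (y j).
Proof.
rewrite hpow_innerE (bigD1 j)//= ffunE eqxx big1 ?addr0// => k kj.
by rewrite ffunE (negPf kj) inner0l.
Qed.

Lemma norm_iota_hpow j h : `|iota_hpow j h| = `|h|.
Proof.
apply/eqP; rewrite -(@eqrXn2 _ 2)// -!inner_norm inner_iota_hpow.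
by rewrite ffunE eqxx.
Qed.

Lemma hpow_sumE (x : hpow H m) : x = \sum_(j < m) iota_hpow j (x j).
Proof.
apply/ffunP => k; rewrite sum_ffunE (bigD1 k)//= ffunE eqxx.
by rewrite big1 ?addr0// => j jk; rewrite ffunE eq_sym (negPf jk).
Qed.

Lemma norm_hpow_coord (x : hpow H m) j : `|x j| <= `|x|.
Proof.
rewrite -(@ler_pXn2r _ 2) ?nnegrE// -!inner_norm hpow_innerE (bigD1 j)//=.
by rewrite lerDl sumr_ge0// => k _; rewrite inner_norm exprn_ge0.
Qed.

End hpow_inner.

Section hpow_complete.
Variables (R : realType) (H : hilbertType R) (m : nat).

Let hpow_complete (F : set_system (hpow H m)) :
  ProperFilter F -> cauchy F -> cvg F.
Proof.
move=> FF Fc.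
have cj (j : 'I_m) : cvg ((fun x : hpow H m => x j) @ F).
  apply: cauchy_cvg; apply/cauchy_ballP => e e0.
  move/cauchy_ballP : Fc => /(_ e e0) [[A B]] /= [FA FB] AB.
  exists ((fun x : hpow H m => x j) @` A, (fun x : hpow H m => x j) @` B).
    split => /=.
      by apply: filterS FA => x Ax; exists x.
    by apply: filterS FB => x Ax; exists x.
  move=> [_ _] /= [[x Ax <-] [y By <-]].
  have := AB (x, y) (conj Ax By); rewrite -!ball_normE /=.
  apply: le_lt_trans; have := norm_hpow_coord (x - y) j.
  by rewrite !ffunE.
pose y : hpow H m := [ffun j => lim ((fun x : hpow H m => x j) @ F)].
apply/cvg_ex; exists y; apply/cvgrPdist_lt => e e0.
have em : 0 < e / m.+1%:R by rewrite divr_gt0.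
have : F [set x : hpow H m | forall j, `|y j - x j| < e / m.+1%:R].
  apply: filter_forall => j; rewrite /y ffunE.
  by have /cvgrPdist_lt/(_ _ em) := cj j.
apply: filterS => x yx; rewrite (hpow_sumE (y - x)).
apply: le_lt_trans (ler_norm_sum _ _ _) _.
apply: (@le_lt_trans _ _ (\sum_(j < m) e / m.+1%:R)).
  apply: ler_sum => j _; rewrite norm_iota_hpow !ffunE.
  by have := ltW (yx j); rewrite ffunE.
rewrite sumr_const card_ord -[_ *+ m]mulr_natl mulrCA gtr_pMr//.
by rewrite ltr_pdivrMr// mul1r ltr_nat.
Qed.

HB.instance Definition _ := Uniform_isComplete.Build (hpow H m) hpow_complete.

End hpow_complete.

Record partial_op (V W : Type) := PartialOp { dom : set V; pfun :> V -> W }.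

Definition total_op (V W : Type) (f : V -> W) : partial_op V W :=
  PartialOp setT f.

Definition comp_op (U V W : Type) (A : partial_op V W) (B : partial_op U V) :
    partial_op U W :=
  PartialOp [set x | dom B x /\ dom A (B x)] (fun x => A (B x)).

Section partial_operators.
Variables (R : realType) (V W : hilbertType R).

Definition linear_op (A : partial_op V W) :=
  dom A 0 /\ forall (a : R[i]) x y, dom A x -> dom A y ->
    dom A (a *: x + y) /\ A (a *: x + y) = a *: A x + A y.

Definition closed_op (A : partial_op V W) :=
  closed [set p : V * W | dom A p.1 /\ A p.1 = p.2].

(* The witness in graph y is unique if dom A is dense. *)
Definition adjoint (A : partial_op V W) : partial_op W V :=
  let graph y := [set w | forall x, dom A x -> inner (A x) y = inner x w] in
  PartialOp [set y | graph y !=set0] (fun y => xget 0 (graph y)).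

(* The inverse of A on its range, if A is injective; 0 outside the range. *)
Definition inv_op (A : partial_op V W) (y : W) : V :=
  xget 0 [set x | dom A x /\ A x = y].

Definition opp_op (A : partial_op V W) : partial_op V W :=
  PartialOp (dom A) (fun x => - A x).

Definition ker_op (A : partial_op V W) : set V := [set x | dom A x /\ A x = 0].

Definition ran_op (A : partial_op V W) : set W := A @` dom A.

End partial_operators.

Section spectral.
Variables (R : realType) (V : hilbertType R).

Definition shift_op (A : partial_op V V) (z : R[i]) : partial_op V V :=
  PartialOp (dom A) (fun x => A x + z *: x).

Definition resolvent_set (A : partial_op V V) : set R[i] :=
  [set z | set_bij (dom A) setT (shift_op A (- z)) /\
           continuous (inv_op (shift_op A (- z)))].

Definition is_basis (K : set V) (n : nat) (e : 'I_n -> V) :=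
  [/\ forall i, K (e i),
      forall c : 'I_n -> R[i], \sum_(i < n) c i *: e i = 0 -> forall i, c i = 0 &
      forall x, K x -> exists c : 'I_n -> R[i], x = \sum_(i < n) c i *: e i].

Definition finite_dim (K : set V) := exists n (e : 'I_n -> V), is_basis K e.

Definition dimension (K : set V) : nat :=
  xget 0%N [set n | exists e : 'I_n -> V, is_basis K e].

Definition Fredholm (M : partial_op V V) :=
  [/\ closed (ran_op M), finite_dim (ker_op M) &
      finite_dim (ker_op (adjoint M))].

Definition fredholm_index (M : partial_op V V) : int :=
  (dimension (ker_op M))%:Z - (dimension (ker_op (adjoint M)))%:Z.

End spectral.

Section trace.
Variables (R : realType) (H : hilbertType R).

Definition separable := exists D : set H, countable D /\ dense D.

Definition strong_cvg (T : nat -> H -> H) (L : H -> H) :=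
  forall h, T n h @[n --> \oo] --> L h.

Definition adj (T : H -> H) : H -> H := adjoint (total_op T).

(* |T|: the unique positive bounded square root of T^* T. In R[i], 0 <= c means
   that c is real and nonnegative. *)
Definition absop (T : H -> H) : H -> H :=
  xget (fun=> 0) [set A | [/\ linear A, continuous A,
    forall h, 0 <= inner (A h) h & forall h, A (A h) = adj T (T h)]].

(* An orthonormal basis as a sequence. Zero vectors are allowed as padding, so
   that finite-dimensional spaces are covered; they contribute 0 to traces. *)
Definition hilbert_basis (e : nat -> H) :=
  [/\ forall i j, i != j -> inner (e i) (e j) = 0,
      forall i, e i = 0 \/ `|e i| = 1 &
      forall x, (forall i, inner x (e i) = 0) -> x = 0].

Definition the_basis : nat -> H := xget (fun=> 0) hilbert_basis.

(* On trace-class operators the choice of the basis does not matter. *)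
Definition trace (T : H -> H) : R[i] :=
  lim (series (fun k => inner (T (the_basis k)) (the_basis k)) @ \oo).

(* The trace of |T|, as a sum of nonnegative terms with value in [0, +oo]. *)
Definition trace_norm (T : H -> H) : \bar R :=
  (\sum_(0 <= k <oo)
     (complex.Re (inner (absop T (the_basis k)) (the_basis k)))%:E)%E.

Definition trace_class (T : H -> H) :=
  [/\ linear T, continuous T & (trace_norm T < +oo)%E].

End trace.

Section witten.
Variables (R : realType) (H : hilbertType R) (m : nat).
Local Notation Hm := (hpow H m).

(* T_jk = iota_j^* T iota_k; by inner_iota_hpow, iota_j^* is the j-th coordinate. *)
Definition block (T : Hm -> Hm) (j k : 'I_m) (h : H) : H :=
  T (iota_hpow k h) j.

Definition internal_trace (T : Hm -> Hm) (h : H) : H :=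
  \sum_(j < m) block T j j h.

Definition B_op (M : partial_op Hm Hm) (z : R[i]) (h : H) : H :=
  z *: internal_trace (fun x =>
    inv_op (shift_op (comp_op (adjoint M) M) z) x
    - inv_op (shift_op (comp_op M (adjoint M)) z) x) h.

End witten.

(* Main.v *)
Require Import Defs.
From mathcomp Require Import all_boot all_order all_algebra.
From mathcomp Require Import complex.
From mathcomp Require Import all_classical all_reals all_analysis.
From mathcomp Require Import ring lra.
From mathcomp Require cyclic separable cyclotomic.

Set Implicit Arguments.
Unset Strict Implicit.
Unset Printing Implicit Defensive.

Import Order.TTheory GRing.Theory Num.Theory.
Import numFieldNormedType.Exports.

Local Open Scope classical_set_scope.
Local Open Scope ring_scope.
Local Open Scope complex_scope.

(** Let A be M* M or M M*, a symmetric nonnegative operator whose kernel is ker M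
    or ker M*. As z -> 0, z (A + z)^-1 tends to the orthogonal projection on this
    kernel, so T B_M(z) S tends in operator norm to T tr_m(P - Q) S, where P and Q
    project on ker M and ker M*. That operator has finite rank, and its trace
    tends to tr P - tr Q = ind M when T and S* tend strongly to the identity. The
    point is to pass from the operator norm to the trace at z = 0.

    Resolvents. The punctured disc of radius delta lies in the resolvent set
    of - A. If the inverse of A - delta/2 had norm above 2/delta, then, its
    norm being approximately an eigenvalue up to sign, A would be singular at a point
    of ]0, delta[; so its norm is at most 2/delta, which amounts to
    |A x|^2 >= delta <A x, x> (spectral_gap). From this inequality and the resolvent
    identity, z (A + z)^-1 is Lipschitz on 0 < |z| <= delta/4, its limit at 0 is the
    projection on the kernel (scaled_res_cvg), and the rest of it is given by a
    Neumann series with geometric remainders (resolvent_expansion).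

    Traces. Each diagonal entry f_k(z) = <T B_M(z) S e_k, e_k> is therefore
    analytic at 0. Moreover sum_k |f_k(z)| is at most the trace norm of
    T B_M(z) S (diagonal_le_trace), hence bounded by some C uniformly in z. Cauchy
    estimates, obtained by averaging over roots of unity, turn this bound into
    |sum_{k<n} f_k(z) - sum_{k<n} f_k(0)| <= c |z| with c independent of n
    (Schwarz_estimate). Letting n tend to infinity gives
    |tr (T B_M(z) S) - tr (T tr_m(P - Q) S)| <= c |z| (trace_estimate), where the
    value at 0 is computed by Parseval.

    The definitions of the trace, of the trace norm and of adjoints involve
    choices. These are made good by an orthonormal basis (separable_basis), by
    adjoints of bounded operators (adjP), built from expansions in that basis, and
    by square roots of positive operators (absopP). The interchange of the limits
    is then the continuity at 0 of a uniform limit. *)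

(** * Real-valued norms *)

Lemma cvg_finsum (K : numFieldType) (V : normedModType K) (T : Type)
    (F : set_system T) {FF : Filter F} I (r : seq I) (f : I -> T -> V) (l : I -> V) :
  (forall i, f i @ F --> l i) ->
  (\sum_(i <- r) f i t) @[t --> F] --> \sum_(i <- r) l i.
Proof.
move=> fl; elim: r => [|i r IH].
  rewrite big_nil; under eq_fun do rewrite big_nil; exact: cvg_cst.
rewrite big_cons; under eq_fun do rewrite big_cons; exact: cvgD.
Qed.

Section RealNorm.
Variable R : realType.

(** Norms in a normed module over R[i] are complex numbers; their real part
    carries the same information and is amenable to real arithmetic. *)
Definition rn (V : normedModType R[i]) (x : V) : R := complex.Re `|x|.

Lemma C_ge0E (z : R[i]) : 0 <= z -> z = (complex.Re z)%:C.
Proof. by move=> z0; rewrite RRe_real// realE z0. Qed.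

Lemma Re_le (z w : R[i]) : z <= w -> complex.Re z <= complex.Re w.
Proof. by rewrite lecE => /andP[]. Qed.

Lemma Re_ge0 (z : R[i]) : 0 <= z -> 0 <= complex.Re z.
Proof. exact: Re_le. Qed.

Lemma ReD (z w : R[i]) : complex.Re (z + w) = complex.Re z + complex.Re w.
Proof. by case: z; case: w. Qed.

Lemma ReN (z : R[i]) : complex.Re (- z) = - complex.Re z.
Proof. by case: z. Qed.

Lemma ReB (z w : R[i]) : complex.Re (z - w) = complex.Re z - complex.Re w.
Proof. by rewrite ReD ReN. Qed.

Lemma Re_sum I (r : seq I) (P : pred I) (F : I -> R[i]) :
  complex.Re (\sum_(i <- r | P i) F i) = \sum_(i <- r | P i) complex.Re (F i).
Proof. by apply: (big_morph (@complex.Re R) ReD). Qed.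

Lemma cRe_realM (r : R) (z : R[i]) : complex.Re (r%:C * z) = r * complex.Re z.
Proof. by case: z => a b /=; rewrite mul0r subr0. Qed.

Lemma ReJ (z : R[i]) : complex.Re (Num.conj z) = complex.Re z.
Proof. by case: z. Qed.

Section Module.
Variable V : normedModType R[i].
Implicit Types x y : V.

Lemma rnE x : `|x| = (rn x)%:C.
Proof. by rewrite /rn -C_ge0E ?normr_ge0. Qed.

Lemma rn_ge0 x : 0 <= rn x.
Proof. by rewrite -ler0c -rnE normr_ge0. Qed.

Lemma rn0 : rn (0 : V) = 0.
Proof. by rewrite /rn normr0. Qed.

Lemma rn_eq0 x : rn x = 0 -> x = 0.
Proof. by move=> x0; apply/eqP; rewrite -normr_eq0 rnE x0. Qed.

Lemma rnN x : rn (- x) = rn x.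
Proof. by rewrite /rn normrN. Qed.

Lemma rn_distC x y : rn (x - y) = rn (y - x).
Proof. by rewrite /rn distrC. Qed.

Lemma rnD x y : rn (x + y) <= rn x + rn y.
Proof. by rewrite -lecR rmorphD /= -!rnE ler_normD. Qed.

Lemma rnB x y : rn (x - y) <= rn x + rn y.
Proof. by rewrite -(rnN y) rnD. Qed.

Lemma rnB_trans z x y : rn (x - y) <= rn (x - z) + rn (z - y).
Proof. by have := rnD (x - z) (z - y); rewrite subrKA. Qed.

Lemma rn_sum I (r : seq I) (P : pred I) (F : I -> V) :
  rn (\sum_(i <- r | P i) F i) <= \sum_(i <- r | P i) rn (F i).
Proof.
elim/big_rec2 : _ => [|i y z _ h]; first by rewrite rn0.
by rewrite (le_trans (rnD _ _))// lerD2l.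
Qed.

Lemma cvg_rnP (T : Type) (F : set_system T) {FF : Filter F} (f : T -> V) (l : V) :
  f @ F --> l <-> forall e : R, 0 < e -> \forall t \near F, rn (l - f t) < e.
Proof.
split=> [/cvgrPdist_lt h e e0|h].
  have /h : 0 < e%:C by rewrite ltcR.
  by apply: filterS => t; rewrite rnE ltcR.
apply/cvgrPdist_lt => e e0.
have e0' : 0 < complex.Re e by move: e0; rewrite ltcE => /andP[].
have := h _ e0'; apply: filterS => t.
by rewrite rnE (C_ge0E (ltW e0)) ltcR.
Qed.

Lemma rn_cvg_unique (T : Type) (F : set_system T) {FF : ProperFilter F}
    (f : T -> V) (a b : V) : f @ F --> a -> f @ F --> b -> a = b.
Proof. by move=> fa fb; apply: (@norm_cvg_unique _ V (f @ F)). Qed.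

End Module.

Lemma rnM (z w : R[i]) : rn (z * w) = rn z * rn w.
Proof.
by apply: (@complexI R); rewrite rmorphM /= -!rnE normrM.
Qed.

Lemma rnZ (V : normedModType R[i]) (z : R[i]) (x : V) : rn (z *: x) = rn z * rn x.
Proof.
by apply: (@complexI R); rewrite rmorphM /= -!rnE normrZ.
Qed.

Lemma rnX (z : R[i]) n : rn (z ^+ n) = rn z ^+ n.
Proof.
by apply: (@complexI R); rewrite rmorphXn /= -!rnE normrX.
Qed.

Lemma rnV (z : R[i]) : rn z^-1 = (rn z)^-1.
Proof.
by apply: (@complexI R); rewrite fmorphV /= -!rnE normfV.
Qed.

Lemma rn1 : rn (1 : R[i]) = 1.
Proof. by rewrite /rn normr1. Qed.

Lemma rn_real (r : R) : rn r%:C = `|r|.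
Proof. by rewrite /rn normc_def /= expr0n /= addr0 sqrtr_sqr. Qed.

Lemma rnJ (z : R[i]) : rn (Num.conj z) = rn z.
Proof. by rewrite /rn norm_conjC. Qed.

Lemma Re_rn (z : R[i]) : `|complex.Re z| <= rn z.
Proof. by rewrite -lecR -rnE normc_ge_Re. Qed.

Lemma rnK (z : R[i]) : ((rn z) ^+ 2)%:C = z * Num.conj z.
Proof. by rewrite rmorphXn /= -rnE normCK. Qed.

Lemma rn_scalar_neq0 (z : R[i]) : (z != 0) = (0 < rn z).
Proof. by rewrite -ltcR -rnE normr_gt0. Qed.

End RealNorm.

(** * Semi-inner products and orthonormalization *)

Section SemiInner.
Variables (R : realType) (V : lmodType R[i]) (b : V -> V -> R[i]).

(** With p, q, c in the roles of b x x, b y y and b x y, the hypothesis says that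
    the form is nonnegative at x + t y. Only these three numbers enter, so the
    inequality also serves forms defined on the domain of a partial operator. *)
Lemma CauchySchwarz_scalar (p q c : R[i]) : 0 <= p -> 0 <= q ->
  (forall t, 0 <= p + Num.conj t * c + t * Num.conj c + t * Num.conj t * q) ->
  rn c ^+ 2 <= complex.Re p * complex.Re q.
Proof.
move=> /[dup] p0 /C_ge0E -> /[dup] q0 /C_ge0E ->.
set P := complex.Re p; set Q := complex.Re q => h.
have P0 : 0 <= P by exact: Re_ge0.
have Q0 : 0 <= Q by exact: Re_ge0.
(* t = -s c with s real *)
have k (s : R) : 0 <= P - 2 * s * rn c ^+ 2 + s ^+ 2 * rn c ^+ 2 * Q.
  rewrite -ler0c; have := h (- s%:C * c).
  rewrite !rmorphM !rmorphN /= conj_Creal ?complex_real//.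
  have -> : (P - 2 * s * rn c ^+ 2 + s ^+ 2 * rn c ^+ 2 * Q)%:C =
      P%:C - 2 * s%:C * (rn c ^+ 2)%:C + s%:C ^+ 2 * (rn c ^+ 2)%:C * Q%:C.
    by rewrite !expr2 rmorphD rmorphB !(rmorphM (real_complex R)) (rmorph_nat (real_complex R)).
  by rewrite rnK; congr (_ <= _); ring.
have [Q00|Q1] := eqVneq Q 0.
  have c0 : 0 <= rn c ^+ 2 by rewrite sqr_ge0.
  rewrite Q00 mulr0 leNgt; apply/negP => c1.
  have := k ((P + 1) / rn c ^+ 2).
  rewrite Q00 mulr0 addr0 -mulrA divfK ?gt_eqF//; lra.
have Q2 : 0 < Q by rewrite lt0r Q1.
have := k (Q^-1).
have -> : P - 2 * Q^-1 * rn c ^+ 2 + Q^-1 ^+ 2 * rn c ^+ 2 * Q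
  = (P * Q - rn c ^+ 2) / Q by field; rewrite Q1.
by rewrite pmulr_lge0 ?invr_gt0// subr_ge0.
Qed.

Hypothesis b_lin : forall a x y z, b (a *: x + y) z = a * b x z + b y z.
Hypothesis b_conj : forall x y, b y x = Num.conj (b x y).
Hypothesis b_ge0 : forall x, 0 <= b x x.

Lemma formDl x y z : b (x + y) z = b x z + b y z.
Proof. by rewrite -[x]scale1r b_lin mul1r scale1r. Qed.

Lemma form0l z : b 0 z = 0.
Proof. by apply: (addrI (b 0 z)); rewrite -formDl !addr0. Qed.

Lemma formZl a x z : b (a *: x) z = a * b x z.
Proof. by rewrite -[a *: x]addr0 b_lin form0l addr0. Qed.

Lemma formNl x z : b (- x) z = - b x z.
Proof. by rewrite -scaleN1r formZl mulN1r. Qed.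

Lemma formBl x y z : b (x - y) z = b x z - b y z.
Proof. by rewrite formDl formNl. Qed.

Lemma form_suml I (r : seq I) (P : pred I) (F : I -> V) z :
  b (\sum_(i <- r | P i) F i) z = \sum_(i <- r | P i) b (F i) z.
Proof. by apply: (big_morph (b^~ z)) => [x y|]; rewrite ?formDl ?form0l. Qed.

Lemma formDr x y z : b z (x + y) = b z x + b z y.
Proof. by rewrite b_conj formDl rmorphD /= -!b_conj. Qed.

Lemma formNr x z : b z (- x) = - b z x.
Proof. by rewrite b_conj formNl rmorphN /= -b_conj. Qed.

Lemma formBr x y z : b z (x - y) = b z x - b z y.
Proof. by rewrite formDr formNr. Qed.

Lemma form0r z : b z 0 = 0.
Proof. by rewrite b_conj form0l rmorph0. Qed.

Lemma formZr a x z : b z (a *: x) = Num.conj a * b z x.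
Proof. by rewrite b_conj formZl rmorphM /= -b_conj. Qed.

Lemma form_sumr I (r : seq I) (P : pred I) (F : I -> V) z :
  b z (\sum_(i <- r | P i) F i) = \sum_(i <- r | P i) b z (F i).
Proof. by apply: (big_morph (b z)) => [x y|]; rewrite ?formDr ?form0r. Qed.

Lemma form_CauchySchwarz x y :
  rn (b x y) ^+ 2 <= complex.Re (b x x) * complex.Re (b y y).
Proof.
apply: CauchySchwarz_scalar => // t.
have := b_ge0 (x + t *: y).
rewrite formDl !formDr !formZl !formZr (b_conj x y).
by congr (_ <= _); ring.
Qed.

Lemma form_null x y : b x x = 0 -> b x y = 0.
Proof.
move=> x0; have := form_CauchySchwarz x y; rewrite x0 mul0r => h.
by apply: rn_eq0; apply/eqP; rewrite -sqrf_eq0 eq_le h sqr_ge0.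
Qed.

(** Zero vectors are tolerated, so that a finite family can be extended to a
    sequence and linearly dependent inputs can be orthonormalized. *)
Definition padded_orthonormal (v : nat -> V) :=
  (forall i j, i != j -> b (v i) (v j) = 0) /\
  (forall i, v i = 0 \/ b (v i) (v i) = 1).

Lemma padded_orthonormal_coef v (c : nat -> R[i]) n j : padded_orthonormal v ->
  (j < n)%N -> b (v j) (v j) = 1 -> b (\sum_(i < n) c i *: v i) (v j) = c j.
Proof.
move=> [v1 v2] jn vj; rewrite form_suml (bigD1 (Ordinal jn))//= formZl vj mulr1.
rewrite big1 ?addr0// => i ij; rewrite formZl v1 ?mulr0//.
Qed.

(** Subtracting the component along the last vector leaves the other coefficients
    unchanged and lowers b x x by the square of the coefficient. *)
Lemma form_Bessel v n x : padded_orthonormal v ->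
  \sum_(i < n) rn (b x (v i)) ^+ 2 <= complex.Re (b x x).
Proof.
move=> [v1 v2]; elim: n x => [|m IH] y; first by rewrite big_ord0 Re_ge0.
rewrite big_ord_recr /=.
pose y' := y - b y (v m) *: v m.
have := IH y'.
have -> : \sum_(i < m) rn (b y' (v i)) ^+ 2 = \sum_(i < m) rn (b y (v i)) ^+ 2.
  apply: eq_bigr => i _; rewrite /y' formBl formZl [b (v m) _]v1 ?mulr0 ?subr0//.
  by rewrite gtn_eqF.
move=> h; rewrite -lerBrDr (le_trans h)//.
rewrite -lecR rmorphB /= -C_ge0E// -C_ge0E// rnK /y'.
rewrite formBl !formBr !formZl !formZr (b_conj y (v m)).
have [->|->] := v2 m; last by rewrite le_eqVlt; apply/orP; left; apply/eqP; ring.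
by rewrite !form0r !(mulr0, mul0r, rmorph0, subr0).
Qed.

(** A vector b-dependent on its predecessors is sent to 0. The form may be
    degenerate, as inner (A x) y is for a positive operator A with a kernel. *)
Definition gs_normalize (r : V) : V :=
  if b r r == 0 then 0 else (sqrtC (b r r))^-1 *: r.

Definition gs_residual (s : seq V) (x : V) : V := x - \sum_(v <- s) b x v *: v.

Fixpoint gs_seq (d : nat -> V) (n : nat) : seq V :=
  if n is n'.+1 then
    rcons (gs_seq d n') (gs_normalize (gs_residual (gs_seq d n') (d n')))
  else [::].

Definition gram_schmidt (d : nat -> V) (n : nat) : V :=
  gs_normalize (gs_residual (gs_seq d n) (d n)).

Lemma gs_seqE d n : gs_seq d n = [seq gram_schmidt d i | i <- iota 0 n].
Proof.
by elim: n => // n IH; rewrite -[in iota _ _]addn1 iotaD map_cat -IH cats1 add0n.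
Qed.

Lemma gs_residualE d n x :
  gs_residual (gs_seq d n) x = x - \sum_(i < n) b x (gram_schmidt d i) *: gram_schmidt d i.
Proof.
by rewrite /gs_residual gs_seqE big_map -{1}(subn0 n) big_mkord.
Qed.

Lemma gs_normalizeP r : gs_normalize r = 0 \/ b (gs_normalize r) (gs_normalize r) = 1.
Proof.
rewrite /gs_normalize; case: ifPn => [_|r0]; [by left|right].
have s0 : sqrtC (b r r) \is Num.real by rewrite ger0_real// sqrtC_ge0.
rewrite formZl formZr conj_Creal ?rpredV// mulrA -invfM -expr2 sqrtCK.
by rewrite mulVf.
Qed.

Lemma gs_normalize_null r x : b r x = 0 -> b (gs_normalize r) x = 0.
Proof.
by move=> r0; rewrite /gs_normalize; case: ifP => _; rewrite ?form0l// formZl r0 mulr0.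
Qed.

Lemma gram_schmidt_orthonormal d : padded_orthonormal (gram_schmidt d).
Proof.
have h2 i : gram_schmidt d i = 0 \/ b (gram_schmidt d i) (gram_schmidt d i) = 1.
  exact: gs_normalizeP.
have h1 n : forall i j, (i < j < n)%N -> b (gram_schmidt d j) (gram_schmidt d i) = 0.
  elim: n => [|n IH] i j /andP[ij]; first by rewrite ltn0.
  rewrite ltnS leq_eqVlt => /orP[/eqP jn|jn]; last by apply: IH; rewrite ij.
  subst j; apply: gs_normalize_null; rewrite gs_residualE formBl.
  have [->|g1] := h2 i; first by rewrite !form0r subrr.
  rewrite form_suml (bigD1 (Ordinal ij))//= formZl g1 mulr1 big1 ?addr0 ?subrr//.
  move=> k ki; rewrite formZl.
  have [ki'|ki'] := ltnP k i.
    by rewrite (b_conj (gram_schmidt d i)) IH ?ki'// rmorph0 mulr0.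
  rewrite IH ?mulr0// ltn_neqAle ki' ltn_ord.
  by rewrite !andbT eq_sym; apply: contra ki => /eqP ki; apply/eqP/val_inj.
split=> // i j ij.
have [ij'|ij'] := ltnP i j; first by rewrite b_conj (h1 j.+1) ?rmorph0// ij' ltnSn.
by rewrite (h1 i.+1)// ltnSn andbT ltn_neqAle eq_sym ij.
Qed.

(** For a degenerate b the residual need not vanish; it is only a null vector. *)
Lemma gram_schmidt_null d n (r := d n - \sum_(i < n.+1) b (d n) (gram_schmidt d i) *: gram_schmidt d i) :
  b r r = 0.
Proof.
have [v1 v2] := gram_schmidt_orthonormal d.
set s := d n - \sum_(i < n) b (d n) (gram_schmidt d i) *: gram_schmidt d i.
have gE : gram_schmidt d n = gs_normalize s.
  by rewrite {1}/gram_schmidt gs_residualE.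
have rE : r = s - b (d n) (gram_schmidt d n) *: gram_schmidt d n.
  by rewrite /r big_ord_recr /= opprD addrA.
rewrite rE; case: (v2 n) => [g0|g1].
  rewrite g0 scaler0 subr0; move: g0; rewrite gE /gs_normalize.
  case: ifPn => [/eqP//|s0] /eqP; rewrite scaler_eq0 invr_eq0 sqrtC_eq0 (negPf s0) /=.
  by move/eqP => ->; rewrite form0l.
have bs : b (d n) (gram_schmidt d n) = b s (gram_schmidt d n).
  rewrite /s formBl form_suml big1 ?subr0// => i _.
  by rewrite formZl v1 ?mulr0// ltn_eqF.
rewrite bs; move: g1; rewrite gE /gs_normalize; case: ifPn => [/eqP s0 _|s0 _].
  by rewrite scaler0 subr0.
have r0 : sqrtC (b s s) \is Num.real by rewrite ger0_real// sqrtC_ge0.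
rewrite formZr conj_Creal ?rpredV// scalerA mulrAC -invfM -expr2 sqrtCK mulVf//.
by rewrite scale1r subrr form0l.
Qed.

Lemma gram_schmidt_residual_null d n m : (n < m)%N ->
  let r := d n - \sum_(i < m) b (d n) (gram_schmidt d i) *: gram_schmidt d i in
  b r r = 0.
Proof.
elim: m => // m IH; rewrite ltnS leq_eqVlt => /orP[/eqP <-|nm].
  exact: gram_schmidt_null.
have {IH} := IH nm; set r := d n - _ => /= r0.
rewrite big_ord_recr /= opprD addrA -/r.
suff -> : b (d n) (gram_schmidt d m) = 0 by rewrite scale0r subr0.
have [v1 v2] := gram_schmidt_orthonormal d.
have := form_null (gram_schmidt d m) r0.
rewrite /r formBl form_suml big1 ?subr0// => i _.
by rewrite formZl v1 ?mulr0// ltn_eqF.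
Qed.

(** Used with W constant, a subspace containing all d n, and with W n the span of
    the first n vectors, which detects linear dependence. *)
Lemma gram_schmidt_in (W : nat -> set V) d :
  (forall n, W n 0) -> (forall n a x y, W n x -> W n y -> W n (a *: x + y)) ->
  (forall n, W n `<=` W n.+1) -> (forall n, W n.+1 (d n)) ->
  forall n, W n.+1 (gram_schmidt d n).
Proof.
move=> W0 Wl Ws Wd n; have [m] := ubnP n; elim: m n => // m IH n; rewrite ltnS => nm.
have WS i j : (i <= j)%N -> W i `<=` W j.
  elim: j => [|j IHj]; first by rewrite leqn0 => /eqP ->.
  by rewrite leq_eqVlt => /orP[/eqP ->//|ij]; apply: (subset_trans (IHj ij)).
have Wr : W n.+1 (d n - \sum_(i < n) b (d n) (gram_schmidt d i) *: gram_schmidt d i).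
  rewrite addrC -scaleN1r; apply: (Wl) => //.
  apply: (big_rec (W n.+1)) => // i x _ Wx; apply: (Wl) => //.
  apply: (WS i.+1) => //; first by rewrite ltnS ltnW.
  by apply: IH; rewrite (leq_trans (ltn_ord i)).
rewrite /gram_schmidt gs_residualE /gs_normalize; case: ifP => // _.
by rewrite -[X in W _ X]addr0; apply: (Wl).
Qed.

End SemiInner.

(** * Hilbert spaces, bounded maps and completeness *)

Section InnerBasics.
Variables (R : realType) (V : preHilbertType R).
Implicit Types x y : V.

Lemma inner_ge0 x : 0 <= inner x x.
Proof. by rewrite inner_norm exprn_ge0. Qed.

Lemma innerxx x : inner x x = (rn x ^+ 2)%:C.
Proof. by rewrite inner_norm rnE rmorphXn. Qed.

Lemma Re_innerxx x : complex.Re (inner x x) = rn x ^+ 2.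
Proof. by rewrite innerxx. Qed.

Lemma inner_eq0 x : inner x x = 0 -> x = 0.
Proof.
by rewrite innerxx => -[/eqP]; rewrite sqrf_eq0 => /eqP; exact: rn_eq0.
Qed.

Definition innerBl := formBl (@inner_linearl R V).
Definition innerBr := formBr (@inner_linearl R V) (@inner_conj R V).
Definition inner_suml := form_suml (@inner_linearl R V).
Definition inner_sumr := form_sumr (@inner_linearl R V) (@inner_conj R V).

Lemma inner_CauchySchwarz x y : rn (inner x y) <= rn x * rn y.
Proof.
have := form_CauchySchwarz (@inner_linearl R V) (@inner_conj R V) inner_ge0 x y.
by rewrite !Re_innerxx -exprMn ler_pXn2r// ?nnegrE ?mulr_ge0// rn_ge0.
Qed.

Lemma Re_inner_le x y : complex.Re (inner x y) <= rn x * rn y.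
Proof.
by rewrite (le_trans (ler_norm _))// (le_trans (Re_rn _)) ?inner_CauchySchwarz.
Qed.

Lemma inner_Bessel (e : nat -> V) n x : padded_orthonormal (@inner R V) e ->
  \sum_(i < n) rn (inner x (e i)) ^+ 2 <= rn x ^+ 2.
Proof.
move=> eo; rewrite -Re_innerxx.
exact: (form_Bessel (@inner_linearl R V) (@inner_conj R V) inner_ge0).
Qed.

Lemma rnD_sqr x y :
  rn (x + y) ^+ 2 = rn x ^+ 2 + 2 * complex.Re (inner x y) + rn y ^+ 2.
Proof.
rewrite -!Re_innerxx innerDl !innerDr !ReD (inner_conj x y) ReJ; ring.
Qed.

End InnerBasics.

Section LinearMaps.
Variables (R : realType) (V W : normedModType R[i]).
Implicit Types (f : V -> W).

Lemma lin0 f : linear f -> f 0 = 0.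
Proof.
by move=> fl; have := fl (-1) 0 0; rewrite scaler0 addr0 scaleN1r addNr.
Qed.

Lemma linD f : linear f -> forall x y, f (x + y) = f x + f y.
Proof. by move=> fl x y; rewrite -[x]scale1r fl !scale1r. Qed.

Lemma linZ f : linear f -> forall a x, f (a *: x) = a *: f x.
Proof. by move=> fl a x; rewrite -[a *: x]addr0 fl lin0// addr0. Qed.

Lemma linN f : linear f -> forall x, f (- x) = - f x.
Proof. by move=> fl x; rewrite -scaleN1r linZ// scaleN1r. Qed.

Lemma linB f : linear f -> forall x y, f (x - y) = f x - f y.
Proof. by move=> fl x y; rewrite linD// linN. Qed.

Lemma lin_sum f I (r : seq I) (P : pred I) (F : I -> V) : linear f ->
  f (\sum_(i <- r | P i) F i) = \sum_(i <- r | P i) f (F i).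
Proof.
by move=> fl; apply: (big_morph f) => [x y|]; rewrite ?linD ?lin0.
Qed.

Lemma lipschitz_continuous f (K : R) :
  (forall x y, rn (f x - f y) <= K * rn (x - y)) -> continuous f.
Proof.
move=> fK x; apply/cvg_rnP => e e0.
have K0 : 0 < `|K| + 1 by rewrite ltr_wpDl.
have /cvg_rnP/(_ (e / (`|K| + 1))) : id @ x --> x by exact: cvg_id.
rewrite divr_gt0// => /(_ isT); apply: filterS => y.
rewrite ltr_pdivlMr// => h; rewrite (le_lt_trans (fK _ _))// (le_lt_trans _ h)//.
rewrite mulrC ler_wpM2l ?rn_ge0// (le_trans (ler_norm _))//.
by rewrite lerDl.
Qed.

Lemma bounded_continuous f (K : R) : linear f ->
  (forall x, rn (f x) <= K * rn x) -> continuous f.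
Proof.
by move=> fl fK; apply: (@lipschitz_continuous _ K) => x y; rewrite -linB.
Qed.

Lemma continuous_bounded f : linear f -> {for 0, continuous f} ->
  exists2 K : R, 0 <= K & forall x, rn (f x) <= K * rn x.
Proof.
move=> fl /cvg_rnP/(_ 1 ltr01); rewrite lin0//.
move=> /nbhs_ballP[d /= d0 h].
have d0' : 0 < complex.Re d by move: d0; rewrite ltcE => /andP[].
exists (2 / complex.Re d) => [|x]; first by rewrite divr_ge0// ltW.
have [x0|x0] := eqVneq (rn x) 0.
  by rewrite (rn_eq0 x0) lin0// !rn0 mulr0.
have xp : 0 < rn x by rewrite lt0r x0 rn_ge0.
pose t := complex.Re d / 2 / rn x.
have tp : 0 < t by rewrite divr_gt0// divr_gt0.
have /= := h (t%:C *: x).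
rewrite -ball_normE /= !sub0r rnN normrN rnE (C_ge0E (ltW d0)) ltcR.
rewrite linZ// !rnZ rn_real gtr0_norm// {1}/t divfK ?gt_eqF//.
rewrite ltr_pdivrMr// ltr_pMr// ltr1n => /(_ isT) h1.
have <- : t^-1 = 2 / complex.Re d * rn x by rewrite /t; field; rewrite !gt_eqF.
by rewrite -[t^-1]mul1r ler_pdivlMr// mulrC ltW.
Qed.

End LinearMaps.

Section CompleteSeq.
Variables (R : realType) (V : hilbertType R).

Lemma complete_seq (u : nat -> V) :
  (forall e : R, 0 < e -> exists N, forall n m, (N <= n)%N -> (n <= m)%N ->
     rn (u m - u n) < e) -> cvgn u.
Proof.
move=> h; apply: cauchy_cvg; apply/cauchy_ballP => e e0.
have e0' : 0 < complex.Re e by move: e0; rewrite ltcE => /andP[].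
have [N hN] := h _ e0'.
exists ([set u n | n in [set n | (N <= n)%N]], [set u n | n in [set n | (N <= n)%N]]).
  by split; exists N => // n /= Nn; exists n.
move=> [_ _] /= [[n Nn <-] [m Nm <-]]; rewrite -ball_normE /=.
rewrite rnE (C_ge0E (ltW e0)) ltcR.
by case/orP: (leq_total n m) => nm; [rewrite rn_distC|]; exact: hN.
Qed.

(** The squared increments are controlled by those of a bounded sequence. This
    shape covers both orthogonal series, where it is Pythagoras, and the
    iteration for the square root. *)
Lemma increment_cvgn (u : nat -> V) (q : nat -> R) (M : R) :
  (forall n, q n <= M) ->
  (forall n m, (n <= m)%N -> rn (u m - u n) ^+ 2 <= q m - q n) -> cvgn u.
Proof.
move=> qM uq.
have qnd : nondecreasing_seq q.
  by move=> n m nm; rewrite -subr_ge0 (le_trans _ (uq _ _ nm))// sqr_ge0.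
have qc : cvgn q.
  by apply: nondecreasing_is_cvgn => //; exists M => _ [n _ <-].
apply: complete_seq => e e0.
have e2 : 0 < e ^+ 2 by rewrite exprn_gt0.
have /cvgrPdist_lt/(_ _ e2)[N _ hN] := qc.
exists N => n m Nn nm; rewrite -(@ltr_pXn2r _ 2) ?nnegrE ?rn_ge0 ?(ltW e0)//.
have ql k : q k <= lim (q @ \oo) by exact: nondecreasing_cvgn_le.
rewrite (le_lt_trans (uq _ _ nm))//.
have := hN n Nn; rewrite /= ger0_norm ?subr_ge0//; apply: le_lt_trans.
by rewrite lerD2r.
Qed.

(** The removable singularity theorem for functions that satisfy a resolvent
    identity: such identities turn bounds into Lipschitz bounds on a punctured
    disc. *)
Lemma lipschitz_at0 (f : R[i] -> V) (r L : R) : 0 < r -> 0 <= L ->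
  (forall z w, 0 < rn z <= r -> 0 < rn w <= r -> rn (f z - f w) <= L * rn (z - w)) ->
  exists l : V, forall z, 0 < rn z <= r -> rn (f z - l) <= L * rn z.
Proof.
move=> r0 L0 fL.
pose t n : R[i] := (r / n.+1%:R)%:C.
have rt n : rn (t n) = r / n.+1%:R by rewrite rn_real gtr0_norm// divr_gt0.
have tp n : 0 < rn (t n) <= r.
  by rewrite rt divr_gt0//= ler_pdivrMr// ler_peMr ?ler1n// ltW.
have t0 (e : R) : 0 < e -> exists N, forall n, (N <= n)%N -> rn (t n) < e.
  move=> e0; have [N _ hN] := near_infty_natSinv_lt (PosNum (divr_gt0 e0 r0)).
  exists N => n /hN /=; rewrite rt ltr_pdivlMr// mulrC; exact.
have fc : cvgn (f \o t).
  apply: complete_seq => e e0.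
  have [|N hN] := t0 (e / (2 * (L + 1))).
    by rewrite divr_gt0// mulr_gt0// ltr_wpDl.
  exists N => n m Nn nm; rewrite /= (le_lt_trans (fL _ _ (tp _) (tp _)))//.
  have := hN n Nn; have := hN m (leq_trans Nn nm).
  rewrite !ltr_pdivlMr ?mulr_gt0 ?ltr_wpDl//.
  have := ler_wpM2l L0 (rnB (t m) (t n)); have := rn_ge0 (t m).
  have := rn_ge0 (t n); lra.
exists (lim ((f \o t) @ \oo)) => z /[dup] zr /andP[z0 _].
set l := lim _.
apply/ler_addgt0Pr => e e0.
have [|N hN] := t0 (e / (2 * (L + 1))).
  by rewrite divr_gt0// mulr_gt0// ltr_wpDl.
have e2 : 0 < e / 2 by rewrite divr_gt0.
have /cvg_rnP/(_ _ e2)[N' _ hN'] := fc.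
have := hN (maxn N N') (leq_maxl _ _).
have := hN' (maxn N N') (leq_maxr _ _); rewrite /= -/l rn_distC.
have := fL z (t (maxn N N')) zr (tp _).
set s := t _; have := rnB_trans (f s) (f z) l.
have := ler_wpM2l L0 (rnB z s); rewrite [_ < e / (2 * _)]ltr_pdivlMr ?mulr_gt0 ?ltr_wpDl//.
have := rn_ge0 s; lra.
Qed.

End CompleteSeq.

Section ScalarSeries.
Variable R : realType.

Lemma rn_i : rn ('i%C : R[i]) = 1.
Proof. by rewrite /rn normc_def /= expr0n expr1n add0r sqrtr1. Qed.

Lemma rn_ReIm (z : R[i]) : rn z <= `|complex.Re z| + `|complex.Im z|.
Proof.
by rewrite {1}(complexE z) (le_trans (rnD _ _))// rn_real rnM rn_real rn_i mul1r.
Qed.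

Lemma Im_rn (z : R[i]) : `|complex.Im z| <= rn z.
Proof. by have := Re_rn (z * 'i%C); rewrite ReiNIm normrN rnM rn_i mulr1. Qed.

Lemma Im_sum I (r : seq I) (P : pred I) (F : I -> R[i]) :
  complex.Im (\sum_(i <- r | P i) F i) = \sum_(i <- r | P i) complex.Im (F i).
Proof. by apply: (big_morph (@complex.Im R)) => [[a b] [c d]|]. Qed.

(** Real and imaginary parts are absolutely convergent real series. *)
Lemma absolute_cvg (c : nat -> R[i]) (C : R) :
  (forall n, \sum_(k < n) rn (c k) <= C) -> cvgn (series c).
Proof.
move=> cC.
have h (f : R[i] -> R) : (forall z, `|f z| <= rn z) -> cvgn (series (f \o c)).
  move=> fz; apply: normed_cvg; apply: nondecreasing_is_cvgn.
    apply: nondecreasing_series => n _ _ /=; exact: normr_ge0.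
  exists C => _ [n _ <-] /=; rewrite seriesEord /=.
  by apply: le_trans (cC n); apply: ler_sum => k _; exact: fz.
have hR := h _ (@Re_rn R); have hI := h _ Im_rn.
apply/cvg_ex; exists (lim (series (@complex.Re R \o c) @ \oo) +i*
  lim (series (@complex.Im R \o c) @ \oo)).
apply/cvg_rnP => e e0; have e2 : 0 < e / 2 by rewrite divr_gt0.
have /cvgrPdist_lt/(_ _ e2) := hR; have /cvgrPdist_lt/(_ _ e2) := hI.
move=> hI' hR'; near=> n; rewrite (le_lt_trans (rn_ReIm _))//.
rewrite (splitr e) ltrD//.
  rewrite (_ : complex.Re _ = lim (series (@complex.Re R \o c) @ \oo) -
     series (@complex.Re R \o c) n); first by near: n; exact: hR'.
  by rewrite ReB !seriesEord /= Re_sum.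
rewrite (_ : complex.Im _ = lim (series (@complex.Im R \o c) @ \oo) -
   series (@complex.Im R \o c) n).
  near: n; exact: hI'.
by rewrite !seriesEord /= -Im_sum; case: (\sum_(_ < _) _).
Unshelve. all: by end_near. Qed.

End ScalarSeries.

(** * Orthonormal bases of separable spaces *)

Section HilbertBasis.
Variables (R : realType) (H : hilbertType R).

(** Orthonormalize a dense sequence: a vector orthogonal to the result is
    orthogonal to a dense set. *)
Lemma separable_basis : separable H -> exists e : nat -> H, hilbert_basis e.
Proof.
move=> [D [Dc Dd]].
have [x0 Dx0] : D !=set0.
  have := Dd setT; rewrite setTI; apply; [by exists 0|exact: openT].
have [d dD] : exists d : nat -> H, D `<=` range d.

  have /pfcard_geP[D0|[f]] := Dc; first by move: Dx0; rewrite D0.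
  exists f => y Dy; have [n _ <-] := @surj _ _ _ _ f y Dy.
  by exists n.
pose e := gram_schmidt (@inner R H) d.
have [e1 e2] := gram_schmidt_orthonormal (@inner_linearl R H) (@inner_conj R H)
  (@inner_ge0 R H) d.
exists e; split=> //.
  move=> i; rewrite /e; case: (e2 i) => [->|h]; [by left|right].
  by apply/eqP; rewrite -(@eqrXn2 _ 2)// -inner_norm h expr1n.
move=> x xe.
have xd n : inner x (d n) = 0.
  have := gram_schmidt_null (@inner_linearl R H) (@inner_conj R H)
    (@inner_ge0 R H) d n.
  move=> /= /inner_eq0 /eqP; rewrite subr_eq0 => /eqP ->.
  rewrite inner_sumr big1// => i _.
  by rewrite innerZr xe mulr0.
apply: contrapT => /eqP xn0.
have xp : 0 < `|x| by rewrite normr_gt0.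
have [y [/= xy /dD[n _ dn]]] : (ball x `|x| `&` D) !=set0.
  apply: Dd; last exact: ball_open.
  by exists x; exact: ballxx.
move: xy; rewrite -ball_normE /= => xy.
have : `|x| ^+ 2 <= `|x - y| ^+ 2.
  rewrite -!inner_norm innerBl !innerBr -dn xd (inner_conj x (d n)) xd rmorph0 !subr0.
  by rewrite sub0r opprK lerDl inner_ge0.
rewrite ler_pXn2r ?nnegrE ?normr_ge0// => h.
by have := lt_le_trans xy h; rewrite ltxx.
Qed.

End HilbertBasis.

Section Parseval.
Variables (R : realType) (H : hilbertType R) (e : nat -> H).
Hypothesis eb : hilbert_basis e.

Lemma inner_continuousl (y : H) : continuous (fun x : H => inner x y : R[i]).
Proof.
apply: (@bounded_continuous _ _ _ _ (rn y)) => [a x z|x].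
  by rewrite inner_linearl.
by rewrite mulrC inner_CauchySchwarz.
Qed.

Lemma inner_continuousr (y : H) : continuous (fun x : H => inner y x : R[i]).
Proof.
apply: (@lipschitz_continuous _ _ _ _ (rn y)) => x z.
by rewrite -innerBr inner_CauchySchwarz.
Qed.

Lemma hilbert_basis_orthonormal : padded_orthonormal (@inner R H) e.
Proof.
have [e1 e2 _] := eb; split=> // i.
by case: (e2 i) => [->|ei]; [left|right; rewrite inner_norm ei expr1n].
Qed.

Lemma rn_basis_le1 i : rn (e i) <= 1.
Proof.
by have [_ e2 _] := eb; case: (e2 i) => [->|]; rewrite ?rn0// /rn => ->.
Qed.

Lemma rn_basis_sum (c : nat -> R[i]) m n : (m <= n)%N ->
  rn (\sum_(m <= i < n) c i *: e i) ^+ 2 <= \sum_(m <= i < n) rn (c i) ^+ 2.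
Proof.
have [e1 e2] := hilbert_basis_orthonormal.
move=> mn; rewrite -(subnKC mn); elim: (n - m)%N => [|k IH].
  by rewrite addn0 !big_geq// rn0 expr0n.
rewrite addnS !big_nat_recr ?leq_addr//= rnD_sqr.
rewrite (_ : inner _ _ = 0) /= ?mulr0 ?addr0.
  rewrite lerD// rnZ exprMn ler_piMr ?sqr_ge0//.
  by rewrite expr_le1 ?rn_ge0 ?rn_basis_le1.
rewrite inner_suml big_nat_cond big1// => i /andP[/andP[mi im] _].
by rewrite innerZl innerZr e1 ?mulr0// ltn_eqF.
Qed.

Lemma basis_series_cvg (c : nat -> R[i]) (M : R) :
  (forall n, \sum_(i < n) rn (c i) ^+ 2 <= M) ->
  cvgn (fun n => \sum_(i < n) c i *: e i).
Proof.
move=> cM; apply: (@increment_cvgn _ _ _ (fun n => \sum_(i < n) rn (c i) ^+ 2) M) => //.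
move=> n m nm; rewrite -!(big_mkord xpredT (fun i => c i *: e i)).
rewrite -!(big_mkord xpredT (fun i => rn (c i) ^+ 2)).
rewrite (big_cat_nat (leq0n n) nm)//= addrAC subrr add0r.
rewrite [in leRHS](big_cat_nat (leq0n n) nm)//= [in leRHS]addrAC subrr add0r.
exact: rn_basis_sum.
Qed.

(** The partial sums converge by Bessel; the limit has the same coefficients as x,
    and the basis is total. *)
Lemma basis_expansion (x : H) :
  (\sum_(i < n) inner x (e i) *: e i) @[n --> \oo] --> x.
Proof.
have [e1 e2] := hilbert_basis_orthonormal.
have hc : cvgn (fun n => \sum_(i < n) inner x (e i) *: e i).
  apply: (@basis_series_cvg (fun i => inner x (e i)) (rn x ^+ 2)) => n.
  exact: inner_Bessel hilbert_basis_orthonormal.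
set y := lim ((fun n => \sum_(i < n) inner x (e i) *: e i) @ \oo).
suff xy : x = y by rewrite [X in _ --> X]xy; exact: hc.
apply/eqP; rewrite -subr_eq0; apply/eqP; have [_ _] := eb; apply=> j.
rewrite innerBl; apply/eqP; rewrite subr_eq0 eq_sym; apply/eqP.
have h1 : inner (\sum_(i < n) inner x (e i) *: e i) (e j) @[n --> \oo] --> inner y (e j).
  exact: (cvg_comp _ _ hc (@inner_continuousl (e j) y)).
apply: (rn_cvg_unique h1); apply: cvg_near_cst; near=> n.
have jn : (j < n)%N by near: n; exact: nbhs_infty_gt.
have [ej0|ej1] := e2 j; first by rewrite ej0 !inner0r.
apply: (@padded_orthonormal_coef _ _ _ (@inner_linearl R H) _ (fun i => inner x (e i))) => //.
Unshelve. all: by end_near. Qed.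

Lemma Parseval (x y : H) :
  (\sum_(i < n) inner x (e i) * inner (e i) y) @[n --> \oo] --> (inner x y : R[i]).
Proof.
have := cvg_comp _ _ (@basis_expansion x) (@inner_continuousl y x).
apply: cvg_trans; apply: near_eq_cvg; near=> n => /=.
by rewrite inner_suml; apply: eq_bigr => i _; rewrite innerZl.
Unshelve. all: by end_near. Qed.

Lemma Parseval_norm (x : H) :
  (\sum_(i < n) rn (inner x (e i)) ^+ 2) @[n --> \oo] --> rn x ^+ 2.
Proof.
apply/cvgrPdist_lt => d d0.
have /cvg_rnP/(_ _ d0) := @Parseval x x; apply: filterS => n.
rewrite innerxx (_ : \sum_(i < n) _ = (\sum_(i < n) rn (inner x (e i)) ^+ 2)%:C).
  by rewrite -rmorphB rn_real.
by rewrite rmorph_sum; apply: eq_bigr => i _ /=; rewrite rnK -inner_conj.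
Qed.

(** The representing vector is the sum of the conjugates of phi (e i) times e i. Testing
    phi on its partial sums s n, with q the sum of the first squared
    coefficients, gives q <= K |s n| <= K sqrt q, hence the uniform bound
    q <= K^2 that makes the series converge. *)
Lemma Riesz (phi : H -> R[i]) (K : R) : linear phi ->
  (forall x, rn (phi x) <= K * rn x) -> exists g, forall x, phi x = inner x g.
Proof.
have [e1 e2] := hilbert_basis_orthonormal.
move=> phil phiK.
pose c i := Num.conj (phi (e i)).
pose s n := \sum_(i < n) c i *: e i.
have phis n : phi (s n) = (\sum_(i < n) rn (c i) ^+ 2)%:C.
  rewrite lin_sum// rmorph_sum; apply: eq_bigr => i _ /=.
  by rewrite linZ// rnK /c conjCK.
have sn n : rn (s n) ^+ 2 <= \sum_(i < n) rn (c i) ^+ 2.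
  by have := @rn_basis_sum c 0 n (leq0n _); rewrite !big_mkord.
have cM n : \sum_(i < n) rn (c i) ^+ 2 <= K ^+ 2.
  have := phiK (s n); rewrite phis rn_real ger0_norm; last first.
    by apply: sumr_ge0 => i _; rewrite sqr_ge0.
  have := sn n; set q := \sum_(i < n) _; have := rn_ge0 (s n).
  set t := rn (s n) => t0 tq qK.
  have q0 : 0 <= q by exact: le_trans (sqr_ge0 _) tq.
  have [->|qn0] := eqVneq q 0; first exact: sqr_ge0.
  have qp : 0 < q by rewrite lt0r qn0.
  have : q ^+ 2 <= (K * t) ^+ 2.
    by rewrite ler_pXn2r// nnegrE (le_trans q0).
  rewrite exprMn => h; have : q ^+ 2 <= K ^+ 2 * q.
    by rewrite (le_trans h)// ler_wpM2l ?sqr_ge0.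
  by rewrite expr2 ler_pM2r.
have sc := basis_series_cvg cM.
exists (lim (s @ \oo)) => x.
have h1 : inner x (s n) @[n --> \oo] --> inner x (lim (s @ \oo)).
  exact: (cvg_comp _ _ sc (@inner_continuousr x (lim (s @ \oo)))).
apply: (rn_cvg_unique _ h1).
have phic : continuous phi by exact: bounded_continuous phiK.
have := cvg_comp _ _ (@basis_expansion x) (phic x).
apply: cvg_trans; apply: near_eq_cvg; near=> n => /=.
rewrite inner_sumr lin_sum//; apply: eq_bigr => i _.
by rewrite linZ// innerZr /c conjCK mulrC.
Unshelve. all: by end_near. Qed.

Lemma adjP (T : H -> H) : linear T -> continuous T ->
  forall x y, inner (T x) y = inner x (adj T y).
Proof.
move=> Tl Tc x y.
have [K K0 TK] := continuous_bounded Tl (Tc 0).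
have [|z|g hg] := @Riesz (fun z => inner (T z) y) (K * rn y).
- by move=> a u v; rewrite Tl inner_linearl.
- rewrite (le_trans (inner_CauchySchwarz _ _))// mulrAC ler_wpM2r ?rn_ge0//.
rewrite /adj /adjoint /=; case: xgetP => [g' _|/(_ g)]; first exact.
by move=> h; exfalso; apply: h => z _.
Qed.

End Parseval.

Section TheBasis.
Variables (R : realType) (H : hilbertType R).

Lemma the_basisP : separable H -> hilbert_basis (@the_basis R H).
Proof. by move=> /separable_basis[e eb]; apply: (@xgetPex _ _ (@hilbert_basis R H)); exists e. Qed.

End TheBasis.

(** * Square roots and the absolute value *)

Section PositiveOperator.
Variables (R : realType) (V : hilbertType R).
Implicit Types A : V -> V.

(** Polarization: the form is real at x + y and at x + i y. *)
Lemma ge0_symmetric A : linear A -> (forall x, 0 <= inner (A x) x) ->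
  forall x y, inner (A x) y = inner x (A y).
Proof.
move=> Al A0 x y.
have real z : Num.conj (inner (A z) z) = inner (A z) z.
  by rewrite conj_Creal// ger0_real.
have h c : c * inner (A y) x + Num.conj c * inner (A x) y =
   Num.conj c * inner x (A y) + c * inner y (A x).
  have := real (x + c *: y); rewrite !(linD Al) !(linZ Al).
  rewrite !(innerDl, innerDr, innerZl, innerZr) !(rmorphD, rmorphM)/= !real.
  rewrite !conjCK -!inner_conj => E.
  apply: (@addrI _ (inner (A x) x + c * (Num.conj c * inner (A y) y))).
  by apply: etrans (etrans _ (esym E)) _; ring.
have h1 := h 1; have h2 := h 'i%C.
rewrite conjC1 in h1.
have ci : Num.conj ('i%C : R[i]) = - 'i%C by rewrite complexiE conjCi.
rewrite ci in h2.
have i0 : ('i%C : R[i]) != 0 by rewrite eq_complex /= oner_eq0 andbF.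
apply/eqP; rewrite -subr_eq0; apply/eqP; apply: (mulfI i0); rewrite mulr0.
apply: (@mulfI _ 2); first by rewrite pnatr_eq0.
rewrite mulr0 -(subrr (0 : R[i])); set b := inner (A x) y; set p := inner x (A y).
transitivity ('i%C * (1 * inner (A y) x + 1 * b - (1 * p + 1 * inner y (A x))) -
  ('i%C * inner (A y) x + - 'i%C * b - (- 'i%C * p + 'i%C * inner y (A x)))).
  by ring.
by rewrite h1 h2 !subrr mulr0 ?subrr.
Qed.

End PositiveOperator.

Section SquareRoot.
Variables (R : realType) (V : hilbertType R).
Implicit Types A : V -> V.

Lemma inner_ext (y z : V) : (forall x, inner x y = inner x z) -> y = z.
Proof.
move=> h; apply/eqP; rewrite -subr_eq0; apply/eqP; apply: inner_eq0.
by rewrite innerBr h subrr.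
Qed.

(** The iteration Y_{n+1} = (X + Y_n^2) / 2 started at 0 produces polynomials in X
    with nonnegative coefficients, dominated in norm by the numerical iteration
    q_n for X = 1. As all Y_n commute, Y_{n+2} - Y_{n+1} factors as
    (Y_{n+1} + Y_n) (Y_{n+1} - Y_n) / 2, and induction bounds the increments of
    Y_n by those of q_n, which increases and stays below 1. *)
Section Iteration.
Variable X : V -> V.
Hypothesis Xl : linear X.
Hypothesis Xs : forall x y, inner (X x) y = inner x (X y).
Hypothesis X1 : forall x, rn (X x) <= rn x.

Fixpoint sqrt_iter n (x : V) : V :=
  if n is n'.+1 then 2^-1 *: (X x + sqrt_iter n' (sqrt_iter n' x)) else 0.

Fixpoint sqrt_bound n : R :=
  if n is n'.+1 then 2^-1 * (1 + sqrt_bound n' ^+ 2) else 0.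

Local Notation Y := sqrt_iter.
Local Notation q := sqrt_bound.

Let q01 n : 0 <= q n <= 1.
Proof. by elim: n => [|n /andP[h1 h2]]; rewrite /= ?lexx ?ler01//; nra. Qed.

Let Yl n : linear (Y n).
Proof.
elim: n => [|n IH] a x y /=; first by rewrite scaler0 addr0.
rewrite !IH Xl scalerA mulrC -scalerA -scalerDr; congr (_ *: _).
by rewrite scalerDr addrACA.
Qed.

Let Ys n x y : inner (Y n x) y = inner x (Y n y).
Proof.
elim: n x y => [|n IH] x y /=; first by rewrite inner0l inner0r.
rewrite innerZl innerZr innerDl innerDr Xs !IH.
by rewrite conj_Creal// rpredV realn.
Qed.

Let rn2V : rn (2^-1 : R[i]) = 2^-1.
Proof. by rewrite rnV (_ : 2 = 2%:C) ?rn_real ?normr_nat// rmorph_nat. Qed.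

Let Yq n x : rn (Y n x) <= q n * rn x.
Proof.
elim: n x => [|n IH] x /=; first by rewrite rn0 mul0r.
rewrite rnZ rn2V -mulrA ler_wpM2l ?invr_ge0// mulrDl mul1r.
rewrite (le_trans (rnD _ _))// lerD// (le_trans (IH _))// expr2 -mulrA.
by rewrite ler_wpM2l//; have /andP[] := q01 n.
Qed.

Let Ycomm Z n : linear Z -> (forall x, Z (X x) = X (Z x)) ->
  forall x, Z (Y n x) = Y n (Z x).
Proof.
move=> Zl ZX; elim: n => [|n IH] x /=; first by rewrite lin0.
by rewrite (linZ Zl) (linD Zl) ZX !IH.
Qed.

Let YY m n x : Y m (Y n x) = Y n (Y m x).
Proof.
apply: Ycomm => // y; apply/esym; exact: Ycomm.
Qed.

Let Ystep n x : rn (Y n.+1 x - Y n x) <= (q n.+1 - q n) * rn x.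
Proof.
elim: n => [|n IH].
  rewrite /= addr0 subr0 rnZ rn2V expr0n addr0 subr0 mulr1.
  by rewrite ler_wpM2l ?invr_ge0.
have -> : Y n.+2 x - Y n.+1 x =
    2^-1 *: (Y n.+1 (Y n.+1 x - Y n x) + Y n (Y n.+1 x - Y n x)).
  rewrite -[Y n.+2 x]/(2^-1 *: (X x + Y n.+1 (Y n.+1 x))).
  rewrite -[in X in _ - X]/(2^-1 *: (X x + Y n (Y n x))) -scalerBr; congr (_ *: _).
  rewrite !(linB (Yl _)) (YY n n.+1) opprD addrACA subrr add0r.
  by rewrite addrA subrK.
have -> : q n.+2 - q n.+1 = 2^-1 * (q n.+1 + q n) * (q n.+1 - q n).
  have E m : q m.+1 = 2^-1 * (1 + q m ^+ 2) by [].
  have := E n; rewrite (E n.+1); move: (q n.+1) (q n) => b c Eb.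
  by rewrite [X in _ - X = _]Eb; ring.
rewrite rnZ rn2V -!mulrA ler_wpM2l ?invr_ge0// (le_trans (rnD _ _))// mulrDl.
have /andP[q0 _] := q01 n; have /andP[q1 _] := q01 n.+1.
by rewrite lerD// (le_trans (Yq _ _))// ler_wpM2l.
Qed.

Let Yqq n m x : (n <= m)%N -> rn (Y m x - Y n x) <= (q m - q n) * rn x.
Proof.
move=> /subnKC <-; elim: (m - n)%N => [|k IH].
  by rewrite addn0 !subrr rn0 mul0r.
rewrite addnS (le_trans (rnB_trans (Y (n + k)%N x) _ _))//.
have := Ystep (n + k)%N x; move: IH; lra.
Qed.

Let qmono n m : (n <= m)%N -> q n <= q m.
Proof.
move=> /subnKC <-; elim: (m - n)%N => [|k IH]; first by rewrite addn0.
by rewrite addnS (le_trans IH)//=; set u := q _; have := sqr_ge0 (1 - u); nra.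
Qed.

Let Yc x : cvgn (Y^~ x).
Proof.
apply: (@increment_cvgn _ _ _ (fun n => q n * rn x ^+ 2) (rn x ^+ 2)) => [n|n m nm].
  by rewrite ler_piMl ?sqr_ge0//; have /andP[] := q01 n.
have /andP[q0 q1] := q01 n; have /andP[p0 p1] := q01 m; have qp := qmono nm.
apply: (@le_trans _ _ (((q m - q n) * rn x) ^+ 2)).
  by rewrite ler_pXn2r ?nnegrE ?mulr_ge0 ?subr_ge0 ?rn_ge0// Yqq.
rewrite exprMn -mulrBl ler_wpM2r ?sqr_ge0//.
by rewrite expr2 ler_piMl ?subr_ge0// lerBlDr (le_trans p1)// lerDl.
Qed.

Let L x := lim (Y n x @[n --> \oo]).

Let YL x : Y n x @[n --> \oo] --> L x.
Proof. exact: Yc. Qed.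

Let Ll : linear L.
Proof.
move=> a x y; apply: (rn_cvg_unique (@YL _)).
rewrite (_ : (fun n => Y n (a *: x + y)) = (fun n => a *: Y n x + Y n y)).
  by apply: cvgD; [apply: cvgZr; exact: (@YL x)|exact: (@YL y)].
by apply/funext => n; rewrite Yl.
Qed.

Let L1 x : rn (L x) <= rn x.
Proof.
apply/ler_addgt0Pr => d d0.
have /cvg_rnP/(_ _ d0)[N _ /(_ N (leqnn _)) /= h] := @YL x.
have := rnD (L x - Y N x) (Y N x); rewrite subrK.
have /andP[_ q1] := q01 N.
have := Yq N x; have := ler_wpM2r (rn_ge0 x) q1; lra.
Qed.

Let Ls x y : inner (L x) y = inner x (L y).
Proof.
have h1 := cvg_comp _ _ (@YL x) (@inner_continuousl _ _ y (L x)).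
have h2 := cvg_comp _ _ (@YL y) (@inner_continuousr _ _ x (L y)).
apply: (rn_cvg_unique h1); move: h2; apply: cvg_trans.
by apply: near_eq_cvg; near=> n; rewrite /= Ys.
Unshelve. all: by end_near. Qed.

Let LE x : L x = 2^-1 *: (X x + L (L x)).
Proof.
have h1 : Y n.+1 x @[n --> \oo] --> L x.
  by have := @YL x; rewrite -(cvg_shiftS (Y^~ x)).
apply: (rn_cvg_unique h1); rewrite /=; apply: cvgZr; apply: cvgD; first exact: cvg_cst.
apply/cvg_rnP => d d0; have d2 : 0 < d / 2 by rewrite divr_gt0.
have /cvg_rnP/(_ _ d2) := @YL (L x); have /cvg_rnP/(_ _ d2) := @YL x.
apply: filterS2 => n h2 h3.
rewrite (le_lt_trans (rnB_trans (Y n (L x)) _ _))// (splitr d) ltrD// -linB//.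
rewrite (le_lt_trans (Yq _ _))// (le_lt_trans _ h2)// ler_piMl ?rn_ge0//.
by have /andP[] := q01 n.
Qed.

Lemma contraction_fixpoint : exists L : V -> V, [/\ linear L,
  forall x y, inner (L x) y = inner x (L y), forall x, rn (L x) <= rn x &
  forall x, L x = 2^-1 *: (X x + L (L x))].
Proof. by exists L. Qed.

End Iteration.

Section Contraction.
Variable A : V -> V.
Hypothesis Al : linear A.
Hypothesis A0 : forall x, 0 <= inner (A x) x.
Hypothesis A1 : forall x, complex.Re (inner (A x) x) <= rn x ^+ 2.

Let X x := x - A x.

Let Xl : linear X.
Proof. by move=> a x y; rewrite /X Al scalerBr opprD addrACA. Qed.

Let Xs x y : inner (X x) y = inner x (X y).
Proof. by rewrite /X innerBl innerBr (ge0_symmetric Al A0). Qed.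

Let X0 x : 0 <= inner (X x) x.
Proof.
by rewrite /X innerBl innerxx (C_ge0E (A0 x)) -rmorphB ler0c subr_ge0.
Qed.

(* Cauchy-Schwarz for the form of X at x and X x turns the bound on the quadratic
   form into a bound on the norm. *)
Let X1 x : rn (X x) <= rn x.
Proof.
have b_lin a u v z : inner (X (a *: u + v)) z = a * inner (X u) z + inner (X v) z.
  by rewrite Xl inner_linearl.
have b_conj u v : inner (X v) u = Num.conj (inner (X u) v).
  by rewrite Xs inner_conj.
have := form_CauchySchwarz (b := fun u v => inner (X u) v) b_lin b_conj X0 x (X x).
have hX y : complex.Re (inner (X y) y) <= rn y ^+ 2.
  by rewrite /X innerBl ReB Re_innerxx gerBl Re_ge0.
rewrite innerxx rn_real ger0_norm ?sqr_ge0// => h.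
have [->|x0] := eqVneq (rn (X x)) 0; first exact: rn_ge0.
have xp : 0 < rn (X x) by rewrite lt0r x0 rn_ge0.
rewrite -(@ler_pXn2r _ 2) ?nnegrE ?rn_ge0//.
rewrite -(ler_pM2r (exprn_gt0 2 xp)) -expr2 (le_trans h)//.
by rewrite ler_pM ?Re_ge0.
Qed.

(** If L = (X + L^2) / 2 with X = 1 - A, then (1 - L)^2 = 1 - X = A. *)
Lemma contraction_sqrt : exists B : V -> V, [/\ linear B, continuous B,
  forall x, 0 <= inner (B x) x & forall x, B (B x) = A x].
Proof.
have [L [Ll Ls L1 LE]] := contraction_fixpoint Xl Xs X1.
pose B x := x - L x.
have Bl : linear B.
  by move=> a x y; rewrite /B Ll scalerBr opprD addrACA.
exists B; split => //.
- apply: (@bounded_continuous _ _ _ _ 2) => // x.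
  by rewrite (le_trans (rnB _ _))// mulr_natl mulr2n lerD2l.
- move=> x; rewrite /B innerBl innerxx.
  have Lr : inner (L x) x \is Num.real.
    by apply/CrealP; rewrite -inner_conj Ls.
  rewrite -(RRe_real Lr) -rmorphB ler0c subr_ge0.
  by rewrite (le_trans (Re_inner_le _ _))// expr2 ler_wpM2r ?rn_ge0.
- move=> x.
  have -> : B (B x) = x - L x - (L x - L (L x)) by rewrite /B (linB Ll).
  have E : L x + L x = x - A x + L (L x).
    by rewrite -mulr2n -scaler_nat {1}LE scalerA divff ?pnatr_eq0// scale1r.
  have -> : A x = x + L (L x) - (L x + L x).
    by rewrite E opprD opprB addrACA subrr addr0 addrC subrK.
  by rewrite opprB opprD addrACA.
Qed.

End Contraction.

Lemma positive_sqrt A : linear A -> continuous A ->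
  (forall x, 0 <= inner (A x) x) -> exists B : V -> V, [/\ linear B, continuous B,
  forall x, 0 <= inner (B x) x & forall x, B (B x) = A x].
Proof.
move=> Al Ac A0; have [K K0 AK] := continuous_bounded Al (Ac 0).
have c0 : 0 < K + 1 by rewrite ltr_wpDl.
pose c : R := (K + 1)^-1.
have ci0 : 0 <= c by rewrite invr_ge0 ltW.
pose A' x := c%:C *: A x.
have A'l : linear A'.
  by move=> a x y; rewrite /A' Al scalerDr !scalerA mulrC.
have A'0 x : 0 <= inner (A' x) x by rewrite innerZl mulr_ge0// ler0c.
have A'1 x : complex.Re (inner (A' x) x) <= rn x ^+ 2.
  rewrite innerZl cRe_realM ler_pdivrMl// (le_trans (Re_inner_le _ _))// expr2 mulrA.
  rewrite ler_wpM2r ?rn_ge0// (le_trans (AK _))//.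
  by rewrite ler_wpM2r ?rn_ge0// lerDl.
have [B [Bl Bc B0 BB]] := contraction_sqrt A'l A'0 A'1.
pose s := Num.sqrt (K + 1).
exists (fun x => s%:C *: B x); split.
- by move=> a x y; rewrite Bl scalerDr !scalerA mulrC.
- by move=> x; apply: cvgZr; exact: Bc.
- by move=> x; rewrite innerZl mulr_ge0// ler0c sqrtr_ge0.
- move=> x; rewrite (linZ Bl) scalerA -rmorphM -expr2 sqr_sqrtr ?ltW// BB /A'.
  by rewrite scalerA -rmorphM mulfV ?gt_eqF// scale1r.
Qed.

End SquareRoot.

(** * Diagonal sums and the trace norm *)

Section AbsoluteValue.
Variables (R : realType) (H : hilbertType R) (e : nat -> H).
Hypothesis eb : hilbert_basis e.
Variable K : H -> H.
Hypotheses (Kl : linear K) (Kc : continuous K).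

Lemma adj_linear : linear (adj K).
Proof.
move=> a x y; apply: inner_ext => z.
by rewrite -(adjP eb)// !innerDr !innerZr -!(adjP eb).
Qed.

Lemma adj_continuous : continuous (adj K).
Proof.
have [C C0 KC] := continuous_bounded Kl (@Kc 0).
apply: (@bounded_continuous _ _ _ _ C) adj_linear _ => y.
have [->|y0] := eqVneq (rn (adj K y)) 0; first by rewrite mulr_ge0// rn_ge0.
have yp : 0 < rn (adj K y) by rewrite lt0r y0 rn_ge0.
rewrite -(ler_pM2l yp) -expr2 -Re_innerxx -(adjP eb)// (le_trans (Re_inner_le _ _))//.
by rewrite mulrA [_ * C]mulrC ler_wpM2r ?rn_ge0.
Qed.

(** A positive square root exists, so the choice made in absop does not fall back
    on its default value. *)
Lemma absopP : [/\ linear (absop K), continuous (absop K),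
  forall h, 0 <= inner (absop K h) h & forall h, absop K (absop K h) = adj K (K h)].
Proof.
rewrite /absop; case: xgetP => [A _ //|noA].
have [|||B hB] := @positive_sqrt _ _ (adj K \o K).
- by move=> a x y /=; rewrite Kl adj_linear.
- by move=> x; apply: continuous_comp; [exact: Kc|exact: adj_continuous].
- by move=> x /=; rewrite inner_conj -(adjP eb)// -inner_conj inner_ge0.
by have := noA B hB.
Qed.

Lemma rn_absop x : rn (absop K x) = rn (K x).
Proof.
have [Al _ A0 AA] := absopP.
apply/eqP; rewrite -(@eqrXn2 _ 2) ?rn_ge0// -!Re_innerxx.
by rewrite (ge0_symmetric Al A0) AA -(adjP eb).
Qed.

(** The inequality of the diagonal sum with the trace norm, proved without polar
    decomposition. Let A = |K| and let v_i orthonormalize e_0, ..., e_{N-1} for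
    the form <A x, y>. A null vector of this form is killed by A, hence by K, so
    K e_k = sum_i <A e_k, v_i> K v_i. By the inequality of the means and Bessel for
    (e_k), the diagonal sum is at most sum_i (|A v_i|^2 + |K v_i|^2) / 2, which
    is sum_i |A v_i|^2. Expanding A v_i in the basis and applying Bessel for the
    form of A to each e_l bounds this by sum_l <A e_l, e_l>. *)
Lemma diagonal_le_trace (C : R) N :
  (forall n, \sum_(l < n) complex.Re (inner (absop K (e l)) (e l)) <= C) ->
  \sum_(k < N) rn (inner (K (e k)) (e k)) <= C.
Proof.
move=> AC; have [Al _ A0 _] := absopP; set A := absop K in Al A0 AC *.
have As := ge0_symmetric Al A0.
pose b x y := inner (A x) y.
have b_lin a x y z : b (a *: x + y) z = a * b x z + b y z.
  by rewrite /b Al inner_linearl.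
have b_conj x y : b y x = Num.conj (b x y) by rewrite /b As inner_conj.
have eo := hilbert_basis_orthonormal eb.
pose v := gram_schmidt b e.
have vo : padded_orthonormal b v by exact: gram_schmidt_orthonormal.
have Ke (k : 'I_N) : K (e k) = \sum_(i < N) b (e k) (v i) *: K (v i).
  apply/eqP; rewrite -subr_eq0.
  have -> : \sum_(i < N) b (e k) (v i) *: K (v i) =
      K (\sum_(i < N) b (e k) (v i) *: v i).
    by rewrite lin_sum//; apply: eq_bigr => i _; rewrite linZ.
  rewrite -(linB Kl); apply/eqP/rn_eq0; rewrite -rn_absop -/A.
  set r := _ - _; have r0 : b r r = 0.
    exact: (gram_schmidt_residual_null b_lin b_conj A0 e (ltn_ord k)).
  have := form_null b_lin b_conj A0 (A r) r0; rewrite /b innerxx => -[/eqP].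
  by rewrite sqrf_eq0 => /eqP.
have h1 (k : 'I_N) : rn (inner (K (e k)) (e k)) <=
    \sum_(i < N) 2^-1 * (rn (inner (A (v i)) (e k)) ^+ 2 + rn (inner (K (v i)) (e k)) ^+ 2).
  rewrite {1}Ke inner_suml (le_trans (rn_sum _ _ _))//; apply: ler_sum => i _.
  rewrite innerZl rnM b_conj rnJ -/(b (v i) (e k)).
  set p := rn _; set q := rn _; have := sqr_ge0 (p - q); rewrite /b -/p; nra.
have h2 : \sum_(k < N) rn (inner (K (e k)) (e k)) <= \sum_(i < N) rn (A (v i)) ^+ 2.
  rewrite (le_trans (ler_sum _ (fun k _ => h1 k)))// exchange_big /=.
  apply: ler_sum => i _; rewrite -mulr_sumr big_split /=.
  have := inner_Bessel N (A (v i)) eo; have := inner_Bessel N (K (v i)) eo.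
  rewrite -(rn_absop (v i)) -/A; lra.
rewrite (le_trans h2)//.
have h3 : (\sum_(i < N) \sum_(l < n) rn (inner (A (v i)) (e l)) ^+ 2) @[n --> \oo] -->
    \sum_(i < N) rn (A (v i)) ^+ 2.
  by apply: cvg_finsum => i; exact: Parseval_norm.
rewrite -(cvg_lim _ h3)//; apply: limr_le; first by apply/cvg_ex; eexists; exact: h3.
near=> n; rewrite exchange_big /= (le_trans _ (AC n))//; apply: ler_sum => l _.
have := form_Bessel b_lin b_conj A0 N (e l) vo; apply: le_trans; apply: ler_sum => i _.
by rewrite b_conj rnJ.
Unshelve. all: by end_near. Qed.

End AbsoluteValue.

(** * Cauchy estimates by averaging over roots of unity *)

Section CauchyEstimate.
Variable R : realType.

Lemma primitive_root_exists n : (0 < n)%N ->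
  exists w : R[i], n.-primitive_root w.
Proof.
move=> n0; pose p : {poly R[i]} := 'X^n - 1.
have [s ps] := closed_field_poly_normal p.
rewrite (monicP _) ?monicXnsubC // scale1r in ps.
have s1 : all n.-unity_root s.
  by apply/allP => z; rewrite -root_prod_XsubC -ps.
have ss : (n < (size s).+1)%N.
  by rewrite -(size_prod_XsubC s id) -ps size_XnsubC.
have [|z _ zn] := hasP (cyclic.has_prim_root n0 s1 _ ss); last by exists z.
by rewrite -separable.separable_prod_XsubC -ps cyclotomic.separable_Xn_sub_1// pnatr_eq0 -lt0n.
Qed.

(** The exponent n - j stands for - j, as w has order n. *)
Lemma primitive_root_sum n (w : R[i]) (i j : 'I_n) : n.-primitive_root w ->
  \sum_(l < n) (w ^+ l) ^+ i * (w ^+ l) ^+ (n - j) = (n * (i == j))%N%:R.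
Proof.
move=> wn; pose x := w ^+ i * w ^+ (n - j).
have -> : \sum_(l < n) (w ^+ l) ^+ i * (w ^+ l) ^+ (n - j) = \sum_(l < n) x ^+ l.
  by apply: eq_bigr => l _; rewrite -!exprM /x exprMn -!exprM mulnC [(l * (n - j))%N]mulnC.
have xn : x ^+ n = 1.
  by rewrite /x exprMn (exprAC w i) (exprAC w (n - j)) (prim_expr_order wn) !expr1n mulr1.
have [ij|ij] := eqVneq i j.
  have -> : x = 1 by rewrite /x ij -exprD (subnKC (ltnW (ltn_ord j))) (prim_expr_order wn).
  by rewrite muln1 -[in RHS](card_ord n) -sumr_const; apply: eq_bigr => l _; rewrite expr1n.
rewrite muln0; have : (x - 1) * \sum_(l < n) x ^+ l = 0 by rewrite -subrX1 xn subrr.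
move/eqP; rewrite mulf_eq0 => /orP[|/eqP//]; rewrite subr_eq0 => /eqP x1.
have : w ^+ i == w ^+ j.
  by rewrite -[w ^+ j]mul1r -x1 /x -mulrA -exprD (subnK (ltnW (ltn_ord j))) (prim_expr_order wn) mulr1.
rewrite (eq_prim_root_expr wn) !modn_small// => /eqP/val_inj ij'.
by rewrite ij' eqxx in ij.
Qed.

Lemma geometric_half_small (D d : R) : 0 < d ->
  exists N0, forall N, (N0 <= N)%N -> D * 2^-1 ^+ N < d.
Proof.
move=> d0; have h : `|2^-1 : R| < 1 by rewrite ger0_norm ?invr_ge0// invf_lt1// ltr1n.
have /cvgrPdist_lt/(_ _ d0)[N0 _ hN] := cvg_geometric D h.
exists N0 => N /hN /=; rewrite sub0r normrN; apply: le_lt_trans.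
exact: ler_norm.
Qed.

(** Analyticity at 0, stated through the remainders that a Neumann series
    provides. *)
Definition geometric_expansion (f : R[i] -> R[i]) (a : nat -> R[i]) (D L r : R) :=
  forall N z, 0 < rn z <= r ->
    rn (f z - \sum_(j < N.+1) a j * z ^+ j) <= D * (L * rn z) ^+ N.+1.

Section Estimate.
Variables (f : R[i] -> R[i]) (a : nat -> R[i]) (D L r C : R).
Hypotheses (D0 : 0 <= D) (L0 : 0 <= L) (r0 : 0 < r) (Lr : L * r <= 2^-1).
Hypothesis fa : geometric_expansion f a D L r.
Hypothesis fC : forall z, 0 < rn z <= r -> rn (f z) <= C.

(** The average of f (r w^l) w^(- j l) over the N-th roots of unity w^l is exactly
    a_j r^j for a polynomial of degree below N, so the error is the remainder of
    order N, which tends to 0 with N. *)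
Lemma Cauchy_estimate j : rn (a j) * r ^+ j <= C.
Proof.
apply/ler_addgt0Pr => d d0.
have [N0 hN0] := geometric_half_small D d0.
pose N := (maxn N0 j).+1; have jN : (j < N)%N by rewrite ltnS leq_maxr.
have [w wN] := primitive_root_exists (ltn0Sn (maxn N0 j)).
have w1 : rn w = 1.
  have := congr1 (@rn R _) (prim_expr_order wN); rewrite rnX rn1 => /eqP.
  by rewrite pexpr_eq1 ?rn_ge0// => /eqP.
pose z (l : nat) : R[i] := r%:C * w ^+ l.
have zr l : rn (z l) = r by rewrite rnM rnX w1 expr1n mulr1 rn_real gtr0_norm.
have zr' l : 0 < rn (z l) <= r by rewrite zr r0 lexx.
pose u (l : nat) : R[i] := (w ^+ l) ^+ (N - j).
have u1 l : rn (u l) = 1 by rewrite /u !rnX w1 !expr1n.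
have E : N%:R * (a j * r%:C ^+ j) =
    \sum_(l < N) f (z l) * u l -
    \sum_(l < N) (f (z l) - \sum_(i < N) a i * z l ^+ i) * u l.
  rewrite -sumrB; under eq_bigr do rewrite -mulrBl subKr mulr_suml.
  rewrite exchange_big /= (bigD1 (Ordinal jN))//= [X in _ + X]big1 ?addr0.
    have := primitive_root_sum (Ordinal jN) (Ordinal jN) wN.
    rewrite eqxx muln1 => <-; rewrite mulr_suml; apply: eq_bigr => l _ /=.
    by rewrite /z /u exprMn; ring.
  move=> i ij; have := primitive_root_sum i (Ordinal jN) wN.
  rewrite (negPf ij) muln0 mulr0n => h.
  transitivity (a i * r%:C ^+ i * \sum_(l < N) (w ^+ l) ^+ i * (w ^+ l) ^+ (N - j)).
    by rewrite mulr_sumr; apply: eq_bigr => l _ /=; rewrite /z /u exprMn; ring.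
  by rewrite [X in _ * X]h mulr0.
have Np : 0 < N%:R :> R by rewrite ltr0n.
rewrite -(ler_pM2l Np).
have -> : N%:R * (rn (a j) * r ^+ j) = rn (N%:R * (a j * r%:C ^+ j)).
  by rewrite !rnM rnX rn_real gtr0_norm// -(rmorph_nat (real_complex R)) rn_real normr_nat.
rewrite E (le_trans (rnB _ _))// mulrDr lerD//.
  rewrite (le_trans (rn_sum _ _ _))// mulr_natl -[in leRHS](card_ord N) -sumr_const.
  by apply: ler_sum => l _; rewrite rnM u1 mulr1 fC.
rewrite (le_trans (rn_sum _ _ _))// mulr_natl -[in leRHS](card_ord N) -sumr_const.
apply: ler_sum => l _; rewrite rnM u1 mulr1 (le_trans (fa _ (zr' l)))// zr.
have /hN0/ltW : (N0 <= N)%N by rewrite ltnW// ltnS leq_maxl.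
apply: le_trans; rewrite ler_wpM2l// ler_pXn2r ?nnegrE ?mulr_ge0 ?invr_ge0//.
exact: ltW.
Qed.

(** Summing the Cauchy estimates as a geometric series. The constant depends on
    the bound C of f but not on D: this uniformity is what lets the estimate pass
    to the limit of the partial sums of the trace. *)
Lemma Schwarz_estimate z : 0 < rn z <= r / 2 -> rn (f z - a 0%N) <= 2 * C / r * rn z.
Proof.
move=> /andP[z0 zr]; apply/ler_addgt0Pr => d d0.
have [N hN] := geometric_half_small D d0.
have zr' : rn z <= r by rewrite (le_trans zr)// ler_pdivrMr// ler_peMr ?ler1n// ltW.
have C0 : 0 <= C.
  have : rn (f z) <= C by apply: fC; rewrite z0.
  exact/le_trans/rn_ge0.
have := rnB_trans (\sum_(j < N.+1) a j * z ^+ j) (f z) (a 0%N).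
move=> /le_trans; apply; rewrite addrC lerD//; last first.
  have := fa N; move=> /(_ z); rewrite z0 zr' => /(_ isT) /le_trans; apply.
  have /hN/ltW : (N <= N.+1)%N by [].
  apply: le_trans; rewrite ler_wpM2l// ler_pXn2r ?nnegrE ?mulr_ge0 ?invr_ge0 ?rn_ge0//.
  by rewrite (le_trans _ Lr)// ler_wpM2l.
rewrite big_ord_recl /= expr0 mulr1 addrAC subrr add0r.
set t := rn z / r.
have t0 : 0 <= t by rewrite divr_ge0 ?rn_ge0// ltW.
have t2 : t <= 2^-1 by rewrite ler_pdivrMr// mulrC.
have -> : 2 * C / r * rn z = 2 * t * C by rewrite /t; ring.
apply: (@le_trans _ _ ((\sum_(j < N) t ^+ j) * (t * C))).
  rewrite (le_trans (rn_sum _ _ _))// mulr_suml; apply: ler_sum => j _.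
  rewrite rnM rnX /bump /= add1n mulrA -exprSr.
  have -> : rn z = t * r by rewrite /t divfK// gt_eqF.
  rewrite exprMn mulrCA ler_wpM2l ?exprn_ge0// Cauchy_estimate//.
rewrite mulrA ler_wpM2r// ler_wpM2r//.
have tN : (1 - t) * (\sum_(j < N) t ^+ j) <= 1.
  have -> : (1 - t) * (\sum_(j < N) t ^+ j) = 1 - t ^+ N.
    by rewrite -opprB mulNr -subrX1 opprB.
  by rewrite gerBl exprn_ge0.
have s0 : 0 <= \sum_(j < N) t ^+ j by apply: sumr_ge0 => j _; rewrite exprn_ge0.
nra.
Qed.

End Estimate.

Lemma geometric_expansionD f g a b D D' L r :
  geometric_expansion f a D L r -> geometric_expansion g b D' L r ->
  geometric_expansion (f \+ g) (a \+ b) (D + D') L r.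
Proof.
move=> fa gb N z zr /=; under eq_bigr do rewrite mulrDl.
rewrite big_split /= opprD addrACA (le_trans (rnD _ _))// mulrDl.
by rewrite lerD ?fa ?gb.
Qed.

Lemma geometric_expansionN f a D L r : geometric_expansion f a D L r ->
  geometric_expansion (fun z => - f z) (fun j => - a j) D L r.
Proof.
move=> fa N z zr /=; under eq_bigr do rewrite mulNr.
by rewrite sumrN -opprD rnN fa.
Qed.

Lemma geometric_expansion_sum I (s : seq I) f a D L r :
  (forall i, geometric_expansion (f i) (a i) (D i) L r) ->
  geometric_expansion (fun z => \sum_(i <- s) f i z) (fun j => \sum_(i <- s) a i j)
    (\sum_(i <- s) D i) L r.
Proof.
move=> fa; elim: s => [|i s IH].
  move=> N z zr; rewrite !big_nil big1 ?subrr ?rn0 ?mul0r// => j _.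
  by rewrite big_nil mul0r.
have := geometric_expansionD (fa i) IH; rewrite big_cons.
congr geometric_expansion; apply/funext => z; rewrite /= ?big_cons//.
Qed.

End CauchyEstimate.

(** * Resolvents of symmetric nonnegative operators near an isolated 0 *)

Section VectorIdentities.
Variables (R : realType) (V : preHilbertType R).
Implicit Types x y z : V.

Lemma innerNl x z : inner (- x) z = - inner x z.
Proof. by rewrite (formNl (@inner_linearl R V)). Qed.

Lemma inner_extl y z : (forall v, inner y v = inner z v) -> y = z.
Proof.
move=> h; apply/eqP; rewrite -subr_eq0; apply/eqP; apply: inner_eq0.
by rewrite innerBl h subrr.
Qed.

End VectorIdentities.

(** An identity between linear combinations of vectors holds once it holds after
    pairing with an arbitrary vector, where it is an identity of scalars. *)
Ltac vector_ring := apply: inner_extl => ?;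
  rewrite ?(innerDl, innerNl, innerZl, inner0l); ring.

Section Resolvent.
Variables (R : realType) (V : hilbertType R) (A : partial_op V V).
Hypothesis Al : linear_op A.

Lemma opl_dom a x y : dom A x -> dom A y -> dom A (a *: x + y).
Proof. by move=> dx dy; have [_ /(_ a x y dx dy)[]] := Al. Qed.

Lemma oplE a x y : dom A x -> dom A y -> A (a *: x + y) = a *: A x + A y.
Proof. by move=> dx dy; have [_ /(_ a x y dx dy)[]] := Al. Qed.

Lemma opl_dom0 : dom A 0. Proof. by case: Al. Qed.

Lemma opl0 : A 0 = 0.
Proof.
have := oplE (-1) opl_dom0 opl_dom0.
by rewrite scaler0 addr0 scaleN1r addNr.
Qed.

Lemma opl_domZ a x : dom A x -> dom A (a *: x).
Proof. by move=> dx; rewrite -[_ *: _]addr0; apply: opl_dom => //; exact: opl_dom0. Qed.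

Lemma oplZ a x : dom A x -> A (a *: x) = a *: A x.
Proof.
by move=> dx; rewrite -[a *: x]addr0 oplE ?opl0 ?addr0//; exact: opl_dom0.
Qed.

Lemma opl_domD x y : dom A x -> dom A y -> dom A (x + y).
Proof. by move=> dx dy; rewrite -[x]scale1r; exact: opl_dom. Qed.

Lemma oplD x y : dom A x -> dom A y -> A (x + y) = A x + A y.
Proof. by move=> dx dy; rewrite -[x in LHS]scale1r oplE// scale1r. Qed.

Definition res z : V -> V := inv_op (shift_op A z).

(** The form in which membership of z in the resolvent set of - A is used. *)
Definition regular z := [/\ forall y, dom A (res z y),
  forall y, A (res z y) + z *: res z y = y,
  forall x, dom A x -> res z (A x + z *: x) = x &
  exists2 K : R, 0 <= K & forall y, rn (res z y) <= K * rn y].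

Lemma resolvent_regular z : resolvent_set (opp_op A) z -> regular z.
Proof.
move=> [[_ inj surj] cont].
have E x y : (- A x + - z *: x = - y) <-> (A x + z *: x = y).
  by rewrite scaleNr -opprD; split => [/oppr_inj|->].
have invE y : res z y = inv_op (shift_op (opp_op A) (- z)) (- y).
  rewrite /res /inv_op; congr xget; apply/seteqP; split => x [dx h]; split => //.
    exact: (proj2 (E x y) h).
  exact: (proj1 (E x y) h).
have ex y : exists x, dom A x /\ A x + z *: x = y.
  have [x dx h] := surj (- y) I; exists x; split; first exact: dx.
  exact: (proj1 (E x y) h).
have P y : dom A (res z y) /\ A (res z y) + z *: res z y = y.
  exact: (@xgetPex _ 0 [set x | dom A x /\ A x + z *: x = y] (ex y)).
have U x : dom A x -> res z (A x + z *: x) = x.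
  move=> dx; have [d1 e1] := P (A x + z *: x).
  apply: inj; [exact: mem_set|exact: mem_set|].
  exact: (etrans (proj2 (E _ _) e1) (esym (proj2 (E x _) erefl))).
have resl : linear (res z).
  move=> a x y; have [dx ex'] := P x; have [dy ey] := P y.
  rewrite -[RHS]U; last exact: opl_dom.
  rewrite oplE// scalerDr scalerA mulrC -scalerA addrACA -scalerDr ex'.
  by rewrite ey.
split=> //.
- by move=> y; have [] := P y.
- by move=> y; have [] := P y.
apply: (continuous_bounded resl).
rewrite (_ : res z = inv_op (shift_op (opp_op A) (- z)) \o -%R); last first.
  by apply/funext => y; rewrite invE.
apply: continuous_comp; first exact: opp_continuous.
exact: cont.
Qed.

Lemma res_linear z : regular z -> linear (res z).
Proof.
move=> [d e u _] a x y; rewrite -[RHS]u; last exact: opl_dom.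
rewrite oplE// scalerDr scalerA mulrC -scalerA addrACA -scalerDr.
by rewrite !e.
Qed.

Lemma resolvent_identity z w y : regular z -> regular w ->
  res z y - res w y = (w - z) *: res z (res w y).
Proof.
move=> rz rw; have [dz ez uz _] := rz; have [dw ew _ _] := rw.
rewrite -(linZ (res_linear rz)); apply/eqP; rewrite subr_eq addrC -subr_eq; apply/eqP.
rewrite -(linB (res_linear rz)) -[RHS](uz _ (dw y)); congr res.
by rewrite -{1}[y]ew scalerBl opprB addrACA subrr addr0.
Qed.

Lemma res_range z y : regular z -> A (res z y) = y - z *: res z y.
Proof. by move=> [_ e _ _]; apply/eqP; rewrite eq_sym subr_eq e. Qed.

Hypothesis As : forall x y, dom A x -> dom A y -> inner (A x) y = inner x (A y).
Hypothesis A0 : forall x, dom A x -> 0 <= inner (A x) x.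

Let q x := complex.Re (inner (A x) x).

Let q_ge0 x : dom A x -> 0 <= q x.
Proof. by move=> dx; rewrite Re_ge0 ?A0. Qed.

Lemma rn_shift x z : dom A x ->
  rn (A x + z *: x) ^+ 2 = rn (A x) ^+ 2 + 2 * complex.Re z * q x + rn z ^+ 2 * rn x ^+ 2.
Proof.
move=> dx; rewrite rnD_sqr rnZ exprMn innerZr (C_ge0E (A0 dx)) -/(q x).
by rewrite [Num.conj z * _]mulrC cRe_realM ReJ; ring.
Qed.

Lemma res_symmetric (t : R) : regular t%:C ->
  forall x y, inner (res t%:C x) y = inner x (res t%:C y).
Proof.
move=> [d e _ _] x y; rewrite -{1}(e y) -{2}(e x) innerDl innerDr As//.
by rewrite innerZl innerZr conj_Creal// complex_real.
Qed.

Variable delta : R.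
Hypothesis delta0 : 0 < delta.
Hypothesis reg : forall z, 0 < rn z < delta -> regular z.

Section Gap.
Let s := delta / 2.
Let B := res (- s)%:C.

Let s0 : 0 < s. Proof. by rewrite divr_gt0. Qed.

Let regR (t : R) : 0 < `|t| < delta -> regular t%:C.
Proof. by move=> h; apply: reg; rewrite rn_real. Qed.

Let regs : regular (- s)%:C.
Proof. by apply: regR; rewrite normrN gtr0_norm// s0 /= /s; have := delta0; lra. Qed.

(* kappa is the square of the operator norm of B. *)
Let resolvent_norm : exists kappa : R, [/\ 0 <= kappa,
  forall y, rn (B y) ^+ 2 <= kappa * rn y ^+ 2 &
  forall k, 0 <= k -> (forall y, rn (B y) ^+ 2 <= k * rn y ^+ 2) -> kappa <= k].
Proof.
pose S := [set k | 0 <= k /\ forall y, rn (B y) ^+ 2 <= k * rn y ^+ 2].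
have [_ _ _ [K K0 BK]] := regs.
have S0 : S !=set0.
  exists (K ^+ 2); split=> [|y]; first exact: sqr_ge0.
  by rewrite -exprMn ler_pXn2r ?nnegrE ?mulr_ge0 ?rn_ge0// BK.
have Sl : has_lbound S by exists 0 => k [].
exists (inf S); split => [|y|k k0 kB].
- by apply: lb_le_inf => // k [].
- have [y0|y0] := eqVneq (rn y) 0.
    have := BK y; rewrite y0 mulr0 => B0.
    have -> : rn (B y) = 0 by apply/eqP; rewrite eq_le B0 rn_ge0.
    by rewrite expr0n mulr0.
  have yp : 0 < rn y ^+ 2 by rewrite exprn_gt0// lt0r y0 rn_ge0.
  rewrite -ler_pdivrMr//; apply: lb_le_inf => // k [_ /(_ y)].
  by rewrite ler_pdivrMr.
- by apply: ge_inf.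
Qed.

(* The norm of B is at most 1/s. Otherwise let k be its square and l = k^(-1/2),
   so that 0 < l < s = delta / 2 and both s + l and s - l lie in ]0, delta[, where
   A - s - l and A - s + l have bounded inverses. Hence their product applied to
   B^2, which is 1 - l^2 B^2, is bounded below by some 1/c. But
   |(1 - l^2 B^2) x|^2 <= |x|^2 - l^2 |B x|^2 because l |B| <= 1, and
   |B x|^2 <= k (1 - c^-2) |x|^2 contradicts the minimality of k. *)
Let resolvent_norm_le y : s ^+ 2 * rn (B y) ^+ 2 <= rn y ^+ 2.
Proof.
have [k [k0 Bk kmin]] := resolvent_norm.
have [d e _ _] := regs.
have ks : s ^+ 2 * k <= 1.
  rewrite leNgt; apply/negP => ks.
  have kp : 0 < k.
    by rewrite lt0r k0 andbT; apply: contraTneq ks => ->; rewrite mulr0 ltr10.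
  pose l := Num.sqrt k^-1.
  have l2 : l ^+ 2 = k^-1 by rewrite sqr_sqrtr// invr_ge0.
  have lp : 0 < l by rewrite sqrtr_gt0 invr_gt0.
  have ls : l < s.
    rewrite -(@ltr_pXn2r _ 2) ?nnegrE ?(ltW lp) ?(ltW s0)// l2.
    by rewrite -[k^-1]mul1r ltr_pdivrMr.
  have r1 : regular (- s - l)%:C.
    by apply: regR; rewrite -opprD normrN gtr0_norm ?addr_gt0//=; move: ls; rewrite /s; lra.
  have r2 : regular (- s + l)%:C.
    apply: regR; rewrite -normrN opprD opprK gtr0_norm ?subr_gt0// ls /=.
    by move: ls lp; rewrite /s; lra.
  have [_ _ u1 [K1 K10 BK1]] := r1; have [_ _ u2 [K2 K20 BK2]] := r2.
  pose c := 1 + l ^+ 2 * (K1 * K2).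
  have c1 : 1 <= c by rewrite lerDl mulr_ge0 ?sqr_ge0// mulr_ge0.
  have cp : 0 < c by exact: lt_le_trans c1.
  (* c^-1 is the lower bound of 1 - l^2 B^2 *)
  have main x : rn (B x) ^+ 2 <= k * (1 - c ^- 2) * rn x ^+ 2.
    set w := B x; set u := B w.
    have Aw : A w = x + s%:C *: w by have := res_range x regs; rewrite {2}rmorphN scaleNr opprK.
    have Au : A u = w + s%:C *: u by have := res_range w regs; rewrite {2}rmorphN scaleNr opprK.
    have dw : dom A w by exact: d.
    have du : dom A u by exact: d.
    have dwu : dom A (w + l%:C *: u) by apply: opl_domD => //; exact: opl_domZ.
    have E2 : A u + (- s + l)%:C *: u = w + l%:C *: u.
      by rewrite Au rmorphD rmorphN; vector_ring.
    have E1 : A (w + l%:C *: u) + (- s - l)%:C *: (w + l%:C *: u) = x - (l ^+ 2)%:C *: u.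
      rewrite oplD//; last exact: opl_domZ.
      have l2C : (l ^+ 2)%:C = l%:C * l%:C by rewrite expr2 rmorphM.
      rewrite oplZ// Aw Au l2C rmorphB rmorphN /=.
      vector_ring.
    have h2 : rn u <= K2 * rn (w + l%:C *: u) by rewrite -E2 -{1}(u2 u du) BK2.
    have h1 : rn (w + l%:C *: u) <= K1 * rn (x - (l ^+ 2)%:C *: u).
      by rewrite -E1 -{1}(u1 _ dwu) BK1.
    have hx : rn x <= c * rn (x - (l ^+ 2)%:C *: u).
      have := rnD (x - (l ^+ 2)%:C *: u) ((l ^+ 2)%:C *: u); rewrite subrK.
      rewrite rnZ rn_real ger0_norm ?sqr_ge0// => /le_trans; apply.
      rewrite /c mulrDl mul1r lerD2l -mulrA ler_wpM2l ?sqr_ge0//.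
      by rewrite (le_trans h2)// [K1 * K2]mulrC -mulrA ler_wpM2l.
    have xu : complex.Re (inner x u) = rn w ^+ 2.
      by rewrite -res_symmetric// Re_innerxx.
    have hC : rn (x - (l ^+ 2)%:C *: u) ^+ 2 <= rn x ^+ 2 - l ^+ 2 * rn w ^+ 2.
      rewrite rnD_sqr -scaleNr innerZr -rmorphN conj_Creal ?complex_real//.
      rewrite cRe_realM xu rnZ rn_real normrN exprMn real_normK ?num_real//.
      have := Bk w; rewrite -/u => Bu.
      have : l ^+ 2 * rn u ^+ 2 <= rn w ^+ 2.
        by rewrite l2 ler_pdivrMl.
      move=> /(ler_wpM2l (sqr_ge0 l)); lra.
    have hx2 : rn x ^+ 2 <= c ^+ 2 * (rn x ^+ 2 - l ^+ 2 * rn w ^+ 2).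
      apply: (@le_trans _ _ ((c * rn (x - (l ^+ 2)%:C *: u)) ^+ 2)).
        by rewrite ler_pXn2r ?nnegrE ?mulr_ge0 ?rn_ge0// ltW.
      by rewrite exprMn ler_wpM2l ?sqr_ge0.
    rewrite -ler_pdivrMl ?exprn_gt0// in hx2.
    rewrite -mulrA -ler_pdivrMl// -l2; lra.
  have : k <= k * (1 - c ^- 2).
    apply: kmin => //; rewrite mulr_ge0// subr_ge0 invf_le1 ?exprn_gt0//.
    by rewrite exprn_ege1.
  rewrite mulrBr mulr1 -subr_ge0 addrAC subrr add0r oppr_ge0; apply/negP; rewrite -ltNge.
  by rewrite mulr_gt0// invr_gt0 exprn_gt0.
have := Bk y => /(ler_wpM2l (sqr_ge0 s)) /le_trans; apply.
by rewrite mulrA ler_piMl ?sqr_ge0.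
Qed.

(** Squaring |(A - s) x| >= s |x| at s = delta / 2. This says that the spectrum of A
    avoids ]0, delta[ without mentioning the spectrum. *)
Lemma spectral_gap x : dom A x -> delta * q x <= rn (A x) ^+ 2.
Proof.
move=> dx; have [_ _ u _] := regs.
have := resolvent_norm_le (A x + (- s)%:C *: x).
rewrite /B u// rn_shift// rn_real normrN real_normK ?num_real//= /s; lra.
Qed.

End Gap.

Let r := delta / 4.

Let r0 : 0 < r. Proof. by rewrite divr_gt0. Qed.

Let small_regular z : 0 < rn z <= r -> regular z.
Proof.
move=> /andP[z0 zr]; apply: reg; rewrite z0 (le_lt_trans zr)//.
by have := delta0; rewrite /r; lra.
Qed.

(** For |z| <= delta / 4 the cross term 2 Re z <A x, x> of |(A + z) x|^2 is absorbed,
    by the gap, in half of |A x|^2. *)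
Lemma rn_shift_ge (z : R[i]) x : rn z <= r -> dom A x ->
  2^-1 * rn (A x) ^+ 2 + rn z ^+ 2 * rn x ^+ 2 <= rn (A x + z *: x) ^+ 2.
Proof.
move=> zr dx; rewrite rn_shift//.
have := spectral_gap dx; have := q_ge0 dx; have := Re_rn z.
rewrite ler_norml => /andP[h _] q0 gap.
have : - r * q x <= complex.Re z * q x.
  by rewrite ler_wpM2r// (le_trans _ h)// lerN2.
move: gap; rewrite /r -/(q x); lra.
Qed.

Lemma res_bounds (z : R[i]) y : 0 < rn z <= r ->
  rn (A (res z y)) ^+ 2 <= 2 * rn y ^+ 2 /\ rn z * rn (res z y) <= rn y.
Proof.
move=> zr; have rz := small_regular zr; have [d e _ _] := rz.
have /andP[_ zr'] := zr; have := rn_shift_ge zr' (d y); rewrite e => h.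
have y0 := rn_ge0 y; split.
  have := mulr_ge0 (sqr_ge0 (rn z)) (sqr_ge0 (rn (res z y))); lra.
rewrite -(@ler_pXn2r _ 2) ?nnegrE ?mulr_ge0 ?rn_ge0// exprMn.
have := sqr_ge0 (rn (A (res z y))); lra.
Qed.

(** On its range A is bounded below: for w = A u, Cauchy-Schwarz for the form of A
    gives |w|^4 = <A u, w>^2 <= <A u, u> <A w, w>, and the gap bounds the two
    factors by |w|^2 / delta and |A w|^2 / delta. *)
Lemma range_gap u : dom A u -> dom A (A u) -> delta * rn (A u) <= rn (A (A u)).
Proof.
move=> du dw; set w := A u.
have [->|w0] := eqVneq (rn w) 0; first by rewrite mulr0 rn_ge0.
have wp : 0 < rn w by rewrite lt0r w0 rn_ge0.
have h : rn (inner (A u) w) ^+ 2 <= q u * q w.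
  apply: CauchySchwarz_scalar => [||t]; [exact: A0|exact: A0|].
  have dt : dom A (u + t *: w) by apply: opl_domD => //; exact: opl_domZ.
  have := A0 dt; rewrite oplD//; last exact: opl_domZ.
  rewrite oplZ// !(innerDl, innerDr, innerZl, innerZr) -inner_conj -As//.
  by congr (_ <= _); ring.
rewrite -/w innerxx rn_real ger0_norm ?sqr_ge0// in h.
have gu := spectral_gap du; have gw := spectral_gap dw.
have qu := q_ge0 du; have qw := q_ge0 dw.
rewrite -/w -/(q u) in gu; rewrite -/(q w) in gw.
rewrite -(@ler_pXn2r _ 2) ?nnegrE ?mulr_ge0 ?rn_ge0 ?(ltW delta0)//.
rewrite -(ler_pM2l (exprn_gt0 2 wp)).
apply: (@le_trans _ _ ((delta * q u) * (delta * q w))).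
  have := ler_wpM2l (sqr_ge0 delta) h; rewrite exprMn; lra.
by rewrite ler_pM// mulr_ge0// ltW.
Qed.

Definition scaled_res z y := z *: res z y.

Lemma res_scaled z y : regular z -> A (res z y) = y - scaled_res z y.
Proof. exact: res_range. Qed.

(** With R_z = (A + z)^-1 the difference is (z - w) v for v = A R_z R_w y. As v is
    in the range of A, delta |v| <= |A v|, and A v = A R_z (A R_w y), where A R_z and
    A R_w have norm at most sqrt 2. *)
Lemma scaled_res_lipschitz y (z w : R[i]) : 0 < rn z <= r -> 0 < rn w <= r ->
  rn (scaled_res z y - scaled_res w y) <= 2 / delta * rn y * rn (z - w).
Proof.
move=> zr wr; have rz := small_regular zr; have rw := small_regular wr.
have [dz ez uz _] := rz; have [dw ew _ _] := rw.
pose u := res z (res w y).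
have Au : A u = res z (A (res w y)).
  rewrite (res_range (res w y) rz) (res_range y rw) (linB (res_linear rz)).
  rewrite (linZ (res_linear rz)).
  have := resolvent_identity y rz rw => /(congr1 (fun x => x + res w y)).
  by rewrite subrK => ->; vector_ring.
have -> : scaled_res z y - scaled_res w y = (z - w) *: A u.
  rewrite (res_range (res w y) rz) /scaled_res.
  have := resolvent_identity y rz rw => /(congr1 (fun x => x + res w y)).
  by rewrite subrK => ->; vector_ring.
rewrite rnZ [leRHS]mulrC ler_wpM2l ?rn_ge0//.
have dAu : dom A (A u) by rewrite Au.
have h0 := range_gap (dz _ : dom A u) dAu.
have [h1 _] := res_bounds (A (res w y)) zr; rewrite -Au in h1.
have [h2 _] := res_bounds y wr.
have h3 : rn (A (A u)) <= 2 * rn y.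
  rewrite -(@ler_pXn2r _ 2) ?nnegrE ?mulr_ge0 ?rn_ge0// exprMn; lra.
by rewrite [2 / delta]mulrC -mulrA ler_pdivlMl// (le_trans h0).
Qed.

Lemma scaled_res_linear z : regular z -> linear (scaled_res z).
Proof.
move=> rz a x y; rewrite /scaled_res (res_linear rz) scalerDr !scalerA.
by rewrite mulrC.
Qed.

Lemma res_ker z x : regular z -> z != 0 -> ker_op A x -> res z x = z^-1 *: x.
Proof.
move=> [_ _ u _] z0 [dx Ax]; rewrite -[RHS]u; last exact: opl_domZ.
by rewrite oplZ// Ax scaler0 add0r scalerA mulfV// scale1r.
Qed.

Lemma scaled_res_ker z x : regular z -> z != 0 -> ker_op A x -> scaled_res z x = x.
Proof. by move=> rz z0 kx; rewrite /scaled_res res_ker// scalerA mulfV// scale1r. Qed.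

(** For identities that are only available up to terms vanishing with t. *)
Lemma rn_small_eq0 (W : normedModType R[i]) (x : W) (K : R) :
  (forall t, 0 < t <= r -> rn x <= K * t) -> x = 0.
Proof.
move=> h; apply: rn_eq0; apply/eqP; rewrite eq_le rn_ge0 andbT.
apply/ler_addgt0Pr => d d0; rewrite add0r.
pose t := Num.min r (d / (`|K| + 1)).
have K0 : 0 < `|K| + 1 by rewrite ltr_wpDl.
have t0 : 0 < t by rewrite lt_min r0 divr_gt0.
have tr : t <= r by rewrite ge_min lexx.
rewrite (le_trans (h t _)) ?t0//.
apply: (@le_trans _ _ ((`|K| + 1) * t)).
  by rewrite ler_pM2r// (le_trans (ler_norm _))// lerDl.
by rewrite mulrC -ler_pdivlMr// ge_min lexx orbT.
Qed.

Lemma rn_realpos (t : R) : 0 < t -> rn (t%:C) = t.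
Proof. by move=> t0; rewrite rn_real gtr0_norm. Qed.

Section Projection.
Variables (I : finType) (p : I -> V).
Hypothesis kerp : forall i, ker_op A (p i).
Hypothesis pker : forall x, ker_op A x -> x = \sum_i inner x (p i) *: p i.

Definition ker_proj y : V := \sum_i inner y (p i) *: p i.

Lemma ker_proj_linear : linear ker_proj.
Proof.
move=> a x y; rewrite /ker_proj scaler_sumr -big_split; apply: eq_bigr => i _ /=.
by rewrite inner_linearl scalerDl scalerA.
Qed.

Lemma ker_proj_in y : ker_op A (ker_proj y).
Proof.
rewrite /ker_proj; elim/big_rec : _ => [|i x _ [dx Ax]].
  by split; [exact: opl_dom0|exact: opl0].
have [di Ai] := kerp i; split; first exact: opl_dom.
by rewrite oplE// Ax Ai scaler0 addr0.
Qed.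

Lemma ker_projK y : ker_op A y -> ker_proj y = y.
Proof. by move=> /pker {2}->. Qed.

Let L := 2 / delta.

Let L0 : 0 <= L. Proof. by rewrite divr_ge0// ltW. Qed.

(** The limit l exists by the Lipschitz bound. It is fixed by r (A + r)^-1, so it is
    in the kernel; its inner product with a kernel vector equals that of y
    because t (A + t)^-1 is symmetric for real t and fixes the kernel. *)
Lemma scaled_res_cvg y (z : R[i]) : 0 < rn z <= r -> rn (scaled_res z y - ker_proj y) <= L * rn y * rn z.
Proof.
move=> zr.
have [||l hl] := @lipschitz_at0 R V (fun z => scaled_res z y) r (L * rn y) r0.
- by rewrite mulr_ge0// rn_ge0.
- by move=> z' w z'r wr; exact: scaled_res_lipschitz.
have tr (t : R) : 0 < t <= r -> 0 < rn t%:C <= r.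
  by move=> /andP[t0 t1]; rewrite rn_realpos// t0.
suff -> : ker_proj y = l by exact: hl.
have rr : 0 < rn r%:C <= r by apply: tr; rewrite r0 lexx.
have rg := small_regular rr.
(* The defect of scaled_res t y from being fixed is
     - t (A + r)^-1 (y - scaled_res t y), of order t. *)
have lE : scaled_res r%:C l = l.
  have [_ _ _ [K K0 resK]] := rg.
  apply/eqP; rewrite -subr_eq0; apply/eqP.
  apply: (@rn_small_eq0 _ _ (r * K * (L * rn y) + L * rn y + K * (rn y + rn y))) => t /[dup] /andP[t0 _] /tr tr'.
  have rt := small_regular tr'.
  have h1 := hl _ tr'; rewrite rn_realpos// in h1.
  have [_ h2] := res_bounds y tr'; rewrite rn_realpos// in h2.
  have E1 : scaled_res r%:C (scaled_res t%:C y) - scaled_res t%:C y = - (t%:C *: res r%:C (y - scaled_res t%:C y)).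
    rewrite -(res_scaled y rt); have [_ _ ur _] := rg; have [dt et _ _] := rt.
    have := ur _ (dt y) => /(congr1 (fun x => t%:C *: x)).
    rewrite (linD (res_linear rg)) (linZ (res_linear rg)) => E2.
    rewrite /scaled_res (linZ (res_linear rg)) -[in X in _ - X]E2; vector_ring.
  have -> : scaled_res r%:C l - l = - scaled_res r%:C (scaled_res t%:C y - l) + (scaled_res t%:C y - l)
     + (scaled_res r%:C (scaled_res t%:C y) - scaled_res t%:C y).
    rewrite (linB (scaled_res_linear rg)); vector_ring.
  rewrite (le_trans (rnD _ _))// E1 rnN rnZ rn_realpos//.
  have h3 : rn (scaled_res r%:C (scaled_res t%:C y - l)) <= r * (K * rn (scaled_res t%:C y - l)).
    by rewrite rnZ rn_realpos// ler_pM2l// resK.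
  have h4 : rn (res r%:C (y - scaled_res t%:C y)) <= K * (rn y + rn y).
    rewrite (le_trans (resK _))// ler_wpM2l// (le_trans (rnB _ _))// lerD2l.
    by rewrite rnZ rn_realpos.
  have := rnD (- scaled_res r%:C (scaled_res t%:C y - l)) (scaled_res t%:C y - l); rewrite rnN => h5.
  have := ler_wpM2l (ltW t0) h4.
  have := ler_wpM2l (ltW r0) (ler_wpM2l K0 h1).
  lra.
have kl : ker_op A l.
  have [d _ _ _] := rg.
  have dl : dom A l by rewrite -lE; exact: opl_domZ.
  split => //; rewrite -{1}lE oplZ//.
  by rewrite res_range// -/(scaled_res r%:C l) lE subrr scaler0.
rewrite (pker kl); apply: eq_bigr => i _; congr (_ *: _).
apply/eqP; rewrite -subr_eq0; apply/eqP.
apply: (@rn_small_eq0 _ _ (L * rn y * rn (p i))) => t /[dup] /andP[t0 _] /tr tr'.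
have h1 := hl _ tr'; rewrite rn_realpos// in h1.
have rt := small_regular tr'.
have -> : inner y (p i) = inner (scaled_res t%:C y) (p i).
  rewrite -{1}(@scaled_res_ker t%:C (p i)) ?rn_scalar_neq0//; last by case/andP: tr'.
  by rewrite innerZl innerZr conj_Creal ?complex_real// res_symmetric.
rewrite -innerBl (le_trans (inner_CauchySchwarz _ _))// mulrAC.
by rewrite ler_wpM2r ?rn_ge0.
Qed.

(** The part of the resolvent on the orthogonal complement of the kernel. *)
Definition reduced_res z y := res z y - z^-1 *: ker_proj y.

Lemma reduced_res_linear z : regular z -> linear (reduced_res z).
Proof.
move=> rz a x y; rewrite /reduced_res (res_linear rz) ker_proj_linear; vector_ring.
Qed.

Lemma scaled_res_reduced z y : z != 0 -> scaled_res z y = ker_proj y + z *: reduced_res z y.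
Proof.
by move=> z0; rewrite /reduced_res scalerBr scalerA mulfV// scale1r addrC subrK.
Qed.

Let small_neq0 (z : R[i]) : 0 < rn z <= r -> z != 0.
Proof. by rewrite rn_scalar_neq0 => /andP[]. Qed.

Lemma reduced_res_bound z y : 0 < rn z <= r -> rn (reduced_res z y) <= L * rn y.
Proof.
move=> /[dup] zr /andP[z0 _]; have zn0 := small_neq0 zr.
rewrite -(ler_pM2l z0) -rnZ.
have -> : z *: reduced_res z y = scaled_res z y - ker_proj y by rewrite scaled_res_reduced// addrC addKr.
by rewrite [leRHS]mulrC scaled_res_cvg.
Qed.

Lemma ker_proj_res z y : regular z -> z != 0 -> ker_proj (res z y) = z^-1 *: ker_proj y.
Proof.
move=> rz z0; rewrite /ker_proj scaler_sumr; apply: eq_bigr => i _; rewrite scalerA.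
congr (_ *: _); have [d e _ _] := rz; have [di Ai] := kerp i.
by rewrite -[in RHS](e y) innerDl As// Ai inner0r add0r innerZl mulKf.
Qed.

Lemma reduced_res_identity z w y : 0 < rn z <= r -> 0 < rn w <= r ->
  reduced_res z y - reduced_res w y = (w - z) *: reduced_res z (reduced_res w y).
Proof.
move=> zr wr; have rz := small_regular zr; have rw := small_regular wr.
have z0 := small_neq0 zr; have w0 := small_neq0 wr.
have PG : ker_proj (reduced_res w y) = 0.
  rewrite /reduced_res (linB ker_proj_linear) (linZ ker_proj_linear) ker_proj_res//.
  by rewrite (ker_projK (ker_proj_in y)) subrr.
rewrite {3}/reduced_res PG scaler0 subr0 /reduced_res (linB (res_linear rz)) (linZ (res_linear rz)).
rewrite scalerBr -resolvent_identity// (@res_ker z (ker_proj y))//; last exact: ker_proj_in.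
have -> : (w - z) *: (w^-1 *: (z^-1 *: ker_proj y)) = z^-1 *: ker_proj y - w^-1 *: ker_proj y.
  rewrite !scalerA -scalerBl; congr (_ *: _); field; by rewrite z0 w0.
vector_ring.
Qed.

(** The reduced resolvent again satisfies the resolvent identity, and it is bounded;
    hence it is Lipschitz and extends to 0. *)
Lemma reduced_res_limit : exists G0 : V -> V, (forall y, rn (G0 y) <= L * rn y) /\
  forall z y, 0 < rn z <= r -> reduced_res z y = G0 y - z *: reduced_res z (G0 y).
Proof.
have h y : exists l, forall z : R[i], 0 < rn z <= r -> rn (reduced_res z y - l) <= L * (L * rn y) * rn z.
  apply: (@lipschitz_at0 R V (fun z => reduced_res z y)) => //.
    exact: (mulr_ge0 L0 (mulr_ge0 L0 (rn_ge0 y))).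
  move=> z w zr wr; rewrite reduced_res_identity// rnZ rn_distC mulrC ler_wpM2r ?rn_ge0//.
  rewrite (le_trans (reduced_res_bound _ zr))// ler_wpM2l//.
  exact: reduced_res_bound.
have [G0 hG0] := choice h.
have tr (t : R) : 0 < t <= r -> 0 < rn t%:C <= r.
  by move=> /andP[t0 t1]; rewrite rn_realpos// t0.
exists G0; split=> [y|z y zr].
  apply/ler_addgt0Pr => d d0.
  pose M := L * (L * rn y); have M0 : 0 <= M by exact: (mulr_ge0 L0 (mulr_ge0 L0 (rn_ge0 y))).
  pose t := Num.min r (d / (M + 1)).
  have K0 : 0 < M + 1 by rewrite ltr_wpDl.
  have t0 : 0 < t by rewrite lt_min r0 divr_gt0.
  have /tr tr' : 0 < t <= r by rewrite t0 ge_min lexx.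
  have := hG0 y _ tr'; rewrite rn_realpos// -/M => h1.
  have h2 : (M + 1) * t <= d by rewrite mulrC -ler_pdivlMr// ge_min lexx orbT.
  have := rnD (reduced_res t%:C y) (G0 y - reduced_res t%:C y); rewrite addrC subrK (rn_distC (G0 y)).
  have := reduced_res_bound y tr'; lra.
have rz := small_regular zr.
apply/eqP; rewrite -subr_eq0; apply/eqP.
apply: (@rn_small_eq0 _ _ (L * (L * rn y) + L * (L * rn y) + rn z * (L * (L * (L * rn y))))) => t /[dup] /andP[tp _] /tr tr'.
have [t0 _] := andP tr'.
have -> : reduced_res z y - (G0 y - z *: reduced_res z (G0 y)) =
   (reduced_res t%:C y - G0 y) + t%:C *: reduced_res z (reduced_res t%:C y) - z *: reduced_res z (reduced_res t%:C y - G0 y).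
  rewrite (linB (reduced_res_linear rz) (reduced_res t%:C y) (G0 y)).
  have := reduced_res_identity y zr tr' => /(congr1 (fun x => x + reduced_res t%:C y)).
  rewrite subrK => ->; move: (reduced_res _ y) (reduced_res z (G0 y)) (reduced_res z (reduced_res _ y)) => c b a.
  by vector_ring.
have h1 := hG0 y _ tr'.
have h2 : rn (t%:C *: reduced_res z (reduced_res t%:C y)) <= rn t%:C * (L * (L * rn y)).
  by rewrite rnZ ler_pM2l// (le_trans (reduced_res_bound _ zr))// ler_wpM2l// reduced_res_bound.
have h3 : rn (z *: reduced_res z (reduced_res t%:C y - G0 y)) <= rn z * (L * (L * (L * rn y) * rn t%:C)).
  rewrite rnZ ler_wpM2l ?rn_ge0// (le_trans (reduced_res_bound _ zr))// ler_wpM2l//.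
rewrite (rn_realpos tp) in h1 h2 h3.
rewrite (le_trans (rnB _ _))// (le_trans (lerD (rnD _ _) (lexx _)))//; lra.
Qed.

(** Iterating reduced_res_limit gives the Neumann series of z (A + z)^-1 with a
    remainder of the same geometric size. *)
Lemma resolvent_expansion : exists G0 : V -> V,
  forall (phi : V -> R[i]) (D : R) (u : V), linear phi ->
    (forall x, rn (phi x) <= D * rn x) -> 0 <= D ->
    geometric_expansion (fun z => phi (scaled_res z u))
      (fun j => if j is j'.+1 then (-1) ^+ j' * phi (iter j G0 u) else phi (ker_proj u))
      (D * rn u) L r.
Proof.
have [G0 [G0L hG0]] := reduced_res_limit; exists G0 => phi D u phil phiD D0 N z zr.
have z0 := small_neq0 zr; have rz := small_regular zr.
have iterL j : rn (iter j G0 u) <= L ^+ j * rn u.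
  elim: j => [|j IH]; first by rewrite expr0 mul1r.
  by rewrite /= (le_trans (G0L _))// exprS -mulrA ler_wpM2l.
have E n : reduced_res z u = \sum_(j < n) (- z) ^+ j *: iter j.+1 G0 u + (- z) ^+ n *: reduced_res z (iter n G0 u).
  elim: n => [|n IH]; first by rewrite big_ord0 expr0 scale1r add0r.
  rewrite IH big_ord_recr /= -addrA; congr (_ + _).
  by rewrite [in LHS](hG0 _ _ zr) exprSr scalerBr scalerA mulrN scaleNr.
rewrite big_ord_recl expr0 mulr1.
have -> : \sum_(i < N) (-1) ^+ i * phi (iter (bump 0 i) G0 u) * z ^+ (bump 0 i) =
   phi (z *: \sum_(j < N) (- z) ^+ j *: iter j.+1 G0 u).
  rewrite (linZ phil) (lin_sum _ _ _ phil) scaler_sumr; apply: eq_bigr => j _.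
  rewrite (linZ phil) /bump /= add1n exprS [(- z) ^+ j]exprNn /GRing.scale /=; ring.
have hv (a b c : V) : a + z *: (b + c) - (a + z *: b) = z *: c by vector_ring.
rewrite (scaled_res_reduced _ z0) (E N) -(linD phil) -(linB phil) hv.
rewrite (le_trans (phiD _))// !rnZ rnX rnN -mulrA ler_wpM2l//.
have h : rn (reduced_res z (iter N G0 u)) <= L * (L ^+ N * rn u).
  by rewrite (le_trans (reduced_res_bound _ zr))// ler_wpM2l.
have -> : rn u * (L * rn z) ^+ N.+1 = rn z * (rn z ^+ N * (L * (L ^+ N * rn u))).
  by rewrite exprMn !exprS; ring.
by rewrite ler_wpM2l ?rn_ge0// ler_wpM2l ?exprn_ge0 ?rn_ge0.
Qed.

End Projection.

End Resolvent.

(** * The operators M* M and M M* and their kernels *)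

Section Adjoint.
Variables (R : realType) (V : hilbertType R) (M : partial_op V V).

Lemma dense_inner_eq0 (D : set V) w : dense D ->
  (forall x, D x -> inner x w = 0) -> w = 0.
Proof.
move=> Dd Dw; apply: contrapT => /eqP w0.
have wp : 0 < `|w| by rewrite normr_gt0.
have [x [/= wx Dx]] : (ball w `|w| `&` D) !=set0.
  by apply: Dd; [exists w; exact: ballxx|exact: ball_open].
move: wx; rewrite -ball_normE /= !rnE ltcR => wx.
have : rn w ^+ 2 <= rn (w - x) ^+ 2.
  rewrite -!Re_innerxx innerBl !innerBr (Dw _ Dx) (inner_conj x) (Dw _ Dx) rmorph0.
  by rewrite subr0 sub0r opprK ReD lerDl Re_innerxx sqr_ge0.
by rewrite ler_pXn2r ?nnegrE ?rn_ge0// leNgt wx.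
Qed.

Hypotheses (Ml : linear_op M) (Md : dense (dom M)).

Lemma adjointP y : dom (adjoint M) y ->
  forall x, dom M x -> inner (M x) y = inner x (adjoint M y).
Proof. by move=> [w hw]; rewrite /adjoint /=; case: xgetP => [? _ //|/(_ w)]. Qed.

Lemma adjoint_unique y w : (forall x, dom M x -> inner (M x) y = inner x w) ->
  dom (adjoint M) y /\ adjoint M y = w.
Proof.
move=> hw; have dy : dom (adjoint M) y by exists w.
split=> //; apply/eqP; rewrite -subr_eq0; apply/eqP.
apply: (dense_inner_eq0 Md) => x dx.
by rewrite innerBr -adjointP// hw// subrr.
Qed.

Lemma adjoint_linear : linear_op (adjoint M).
Proof.
split=> [|a x y dx dy].
  by have [] := @adjoint_unique 0 0 (fun x _ => etrans (inner0r _) (esym (inner0r _))).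
apply: adjoint_unique => z dz.
by rewrite !innerDr !innerZr !adjointP.
Qed.

Let N := adjoint M.

Let MN x y : dom M x -> dom N y -> inner (M x) y = inner x (N y).
Proof. by move=> dx dy; exact: adjointP. Qed.

Lemma comp_linear (A B : partial_op V V) : linear_op A -> linear_op B ->
  linear_op (comp_op A B).
Proof.
move=> Al Bl; split=> [|a x y [dx dBx] [dy dBy]].
  by split; [exact: opl_dom0|rewrite (opl0 Bl); exact: opl_dom0].
have E := oplE Bl a dx dy; split.
  by split; [exact: opl_dom|rewrite E; exact: opl_dom].
by rewrite /= E oplE.
Qed.

Let NM := comp_op N M.
Let MN' := comp_op M N.

Lemma adjoint_comp_symmetric x y : dom NM x -> dom NM y ->
  inner (NM x) y = inner x (NM y).
Proof.
move=> [dx dMx] [dy dMy] /=.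
by rewrite -MN// inner_conj -MN// -inner_conj.
Qed.

Lemma adjoint_comp_ge0 x : dom NM x -> 0 <= inner (NM x) x.
Proof. by move=> [dx dMx] /=; rewrite inner_conj -MN// -inner_conj inner_ge0. Qed.

Lemma comp_adjoint_symmetric x y : dom MN' x -> dom MN' y ->
  inner (MN' x) y = inner x (MN' y).
Proof.
move=> [dx dNx] [dy dNy] /=.
by rewrite MN// [RHS]inner_conj MN// -inner_conj.
Qed.

Lemma comp_adjoint_ge0 x : dom MN' x -> 0 <= inner (MN' x) x.
Proof. by move=> [dx dNx] /=; rewrite MN// inner_ge0. Qed.

(** On this kernel |M x|^2 = <x, M* M x> = 0. *)
Lemma ker_adjoint_comp : ker_op NM = ker_op M.
Proof.
apply/seteqP; split=> x [].
  move=> [dx dMx] Nx; split=> //; apply: inner_eq0.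
  by rewrite MN// -[N (M x)]/(NM x) Nx inner0r.
move=> dx Mx; split; last by rewrite -[NM x]/(N (M x)) Mx; exact: opl0 adjoint_linear.
by split=> //; rewrite Mx; exact: opl_dom0 adjoint_linear.
Qed.

Lemma ker_comp_adjoint : ker_op MN' = ker_op N.
Proof.
apply/seteqP; split=> x [].
  move=> [dx dNx] Mx; split=> //; apply: inner_eq0.
  by rewrite -MN// -[M (N x)]/(MN' x) Mx inner0l.
move=> dx Nx; split; last by rewrite -[MN' x]/(M (N x)) Nx; exact: opl0 Ml.
by split=> //; rewrite Nx; exact: opl_dom0 Ml.
Qed.

End Adjoint.

Section OrthonormalBasis.
Variables (R : realType) (V : hilbertType R).

(** Orthonormalize a basis of the length that dimension selects. A zero output at i
    would express e i through its predecessors, so all n vectors survive. *)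
Lemma orthonormal_basis_exists (K : set V) : K 0 ->
  (forall a x y, K x -> K y -> K (a *: x + y)) -> finite_dim K ->
  exists p : 'I_(dimension K) -> V, [/\ forall i, K (p i), forall i, inner (p i) (p i) = 1 &
    forall x, K x -> x = \sum_i inner x (p i) *: p i].
Proof.
move=> K0 Kl Kfin.
have : exists e : 'I_(dimension K) -> V, is_basis K e.
  rewrite /dimension; case: xgetP => // /(_ _)noN.
  by have [n [e he]] := Kfin; exfalso; apply: (noN n); exists e.
move: (dimension K) => n [e [eK efree espan]].
pose d (k : nat) : V := if insub k is Some i then e i else 0.
have dE (i : 'I_n) : d i = e i by rewrite /d valK.
pose v := gram_schmidt (@inner R V) d.
have [v1 v2] : padded_orthonormal (@inner R V) v.
  exact: (gram_schmidt_orthonormal (@inner_linearl R V) (@inner_conj R V) (@inner_ge0 R V)).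
have vin := gram_schmidt_in (@inner R V).
have Kd k : K (d k) by rewrite /d; case: insub.
have vK k : K (v k).
  exact: (vin (fun _ => K) d (fun _ => K0) (fun _ => Kl) (fun _ _ h => h) Kd).
have dsum k m : (k < m)%N -> d k = \sum_(i < m) inner (d k) (v i) *: v i.
  move=> km; apply/eqP; rewrite -subr_eq0; apply/eqP/inner_eq0.
  exact: (gram_schmidt_residual_null (@inner_linearl R V) (@inner_conj R V) (@inner_ge0 R V) d km).
exists (fun i => v i); split=> [//|i|x Kx].
  case: (v2 i) => // vi0; exfalso.
  pose W (j : nat) := [set x | exists c : 'I_n -> R[i],
    (forall k : 'I_n, (j <= k)%N -> c k = 0) /\ x = \sum_k c k *: e k].
  have W0 j : W j 0.
    by exists (fun=> 0); split=> //; rewrite big1// => k _; rewrite scale0r.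
  have Wl j a x y : W j x -> W j y -> W j (a *: x + y).
    move=> [c [c0 ->]] [c' [c'0 ->]]; exists (fun k => a * c k + c' k); split=> [k jk|].
      by rewrite c0// c'0// mulr0 addr0.
    rewrite scaler_sumr -big_split; apply: eq_bigr => k _ /=.
    by rewrite scalerDl scalerA.
  have WS j : W j `<=` W j.+1.
    by move=> x [c [c0 ->]]; exists c; split=> // k jk; rewrite c0// ltnW.
  have Wd j : W j.+1 (d j).
    have [jn|jn] := ltnP j n; last first.
      by rewrite /d insubF ?ltnNge ?jn//; exact: W0.
    exists (fun k : 'I_n => (k == Ordinal jn)%:R); split=> [k jk|].
      by rewrite (_ : k == _ = false)//; apply/eqP => kj; rewrite kj /= ltnn in jk.
    rewrite (bigD1 (Ordinal jn))//= eqxx scale1r big1 ?addr0.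
      by rewrite -dE.
    by move=> k /negPf ->; rewrite scale0r.
  have vW := vin W d W0 Wl WS Wd.
  have Wmono j k : (j <= k)%N -> W j `<=` W k.
    elim: k => [|k IH]; first by rewrite leqn0 => /eqP ->.
    by rewrite leq_eqVlt => /orP[/eqP ->//|jk]; apply: (subset_trans (IH jk)).
  have : W i (d i).
    rewrite (dsum i i.+1)// big_ord_recr /= vi0 scaler0 addr0.
    apply: (big_rec (W i)) => // j x _ Wx; apply: (Wl) => //.
    by apply: (Wmono j.+1) => //; exact: vW.
  move=> [c [c0 cE]]; have := efree (fun k => (k == i)%:R - c k).
  have -> : \sum_k ((k == i)%:R - c k) *: e k = 0.
    rewrite (eq_bigr (fun k => (k == i)%:R *: e k - c k *: e k)); last first.
      by move=> k _; rewrite scalerBl.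
    rewrite sumrB -cE dE (bigD1 i)//= eqxx scale1r big1 ?addr0 ?subrr//.
    by move=> k /negPf ->; rewrite scale0r.
  move=> /(_ erefl i); rewrite eqxx c0// subr0 => /eqP.
  by rewrite oner_eq0.
have [c xE] := espan x Kx.
have h : x = \sum_(k < n) c k *: \sum_(i < n) inner (e k) (v i) *: v i.
  by rewrite {1}xE; apply: eq_bigr => k _; rewrite -{1}dE {1}(dsum k n)// dE.
rewrite {1}h; under eq_bigr do rewrite scaler_sumr.
rewrite exchange_big /=; apply: eq_bigr => i _.
rewrite {1}xE inner_suml scaler_suml; apply: eq_bigr => k _.
by rewrite innerZl scalerA.
Qed.

End OrthonormalBasis.

(** * The trace near 0 and the index *)

Section Limits.
Variable R : realType.

Lemma cvg_rn_le (T : Type) (F : set_system T) {FF : ProperFilter F}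
    (V : normedModType R[i]) (u v : T -> V) (a b : V) (C : R) :
  u @ F --> a -> v @ F --> b -> (\forall t \near F, rn (u t - v t) <= C) ->
  rn (a - b) <= C.
Proof.
move=> ua vb uv; apply/ler_addgt0Pr => d d0.
have d2 : 0 < d / 2 by rewrite divr_gt0.
move/cvg_rnP/(_ _ d2) : ua => ua; move/cvg_rnP/(_ _ d2) : vb => vb.
have [t [[h1 h2] h3]] : exists t, (rn (a - u t) < d / 2 /\ rn (b - v t) < d / 2) /\
    rn (u t - v t) <= C.
  by apply: (@filter_ex _ F FF); near=> t; split; [split|]; near: t.
have := rnB_trans (u t) a b; have := rnB_trans (v t) (u t) b.
rewrite (rn_distC (v t)); lra.
Unshelve. all: by end_near. Qed.

Lemma cvg_inner (V : preHilbertType R) (u v : nat -> V) (a b : V) :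
  u n @[n --> \oo] --> a -> v n @[n --> \oo] --> b ->
  inner (u n) (v n) @[n --> \oo] --> (inner a b : R[i]).
Proof.
move=> ua vb; apply/cvg_rnP => d d0.
pose K := rn a + rn b + 1.
have K0 : 0 < K by rewrite ltr_wpDl// addr_ge0 ?rn_ge0.
have dK : 0 < d / (2 * K) by rewrite divr_gt0// mulr_gt0.
move/cvg_rnP : ua => ua; move/cvg_rnP : vb => vb; near=> n.
have h1 : rn (a - u n) < d / (2 * K) by near: n; exact: ua.
have h2 : rn (b - v n) < d / (2 * K) by near: n; exact: vb.
have h3 : rn (b - v n) < 1 by near: n; exact: vb.
have -> : inner a b - inner (u n) (v n) = inner (a - u n) (v n) + inner a (b - v n).
  by rewrite innerBl innerBr [RHS]addrC addrA subrK.
rewrite (le_lt_trans (rnD _ _))//.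
have h4 := inner_CauchySchwarz (a - u n) (v n).
have h5 := inner_CauchySchwarz a (b - v n).
have h6 : rn (v n) <= rn b + 1.
  by have := rnD (v n - b) b; rewrite subrK rn_distC; lra.
rewrite [_ < d / _]ltr_pdivlMr ?mulr_gt0// in h1.
rewrite [_ < d / _]ltr_pdivlMr ?mulr_gt0// in h2.
have := rn_ge0 a; have := rn_ge0 b; have := rn_ge0 (a - u n); have := rn_ge0 (b - v n).
have := rn_ge0 (v n) => p1 p2 p3 p4 p5.
have e1 : rn (a - u n) * rn (v n) <= rn (a - u n) * K.
  by rewrite ler_wpM2l// /K; lra.
have e2 : rn a * rn (b - v n) <= rn (b - v n) * K.
  by rewrite mulrC ler_wpM2l// /K; lra.
lra.
Unshelve. all: by end_near. Qed.

Lemma dnbhs0_small (r : R) : 0 < r ->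
  \forall z \near (0 : R[i])^', z != 0 /\ rn z < r.
Proof.
move=> r0; have /cvg_rnP/(_ _ r0) : (id : R[i] -> R[i]) @ (0 : R[i])^' --> (0 : R[i]).
  exact: cvg_within.
move=> h; near=> z; split; first by near: z; exact: nbhs_dnbhs_neq.
by rewrite -rnN -[- z]add0r; near: z.
Unshelve. all: by end_near. Qed.

Lemma cvg_at0 (V : normedModType R[i]) (f : R[i] -> V) (l : V) (C r : R) : 0 < r ->
  (forall z, 0 < rn z <= r -> rn (f z - l) <= C * rn z) ->
  f z @[z --> 0^'] --> l.
Proof.
move=> r0 fC; apply/cvg_rnP => d d0.
have K0 : 0 < `|C| + 1 by rewrite ltr_wpDl.
have t0 : 0 < Num.min r (d / (`|C| + 1)) by rewrite lt_min r0 divr_gt0.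
have := dnbhs0_small t0.
apply: filterS => z [z0]; rewrite lt_min => /andP[zr zd].
rewrite rn_distC (le_lt_trans (fC z _))//; first by rewrite -rn_scalar_neq0 z0 ltW.
rewrite ltr_pdivlMr// in zd; apply: le_lt_trans zd.
rewrite mulrC ler_wpM2l ?rn_ge0// (le_trans (ler_norm _))//.
by rewrite lerDl.
Qed.

End Limits.

Section WittenIndex.
Variables (R : realType) (H : hilbertType R) (m : nat).
Local Notation Hm := (hpow H m).
Variables (M : partial_op Hm Hm).
Hypotheses (Hsep : separable H) (Ml : linear_op M) (Md : dense (dom M)).

Local Notation N := (adjoint M).
Local Notation e := (@the_basis R H).

Let eb : hilbert_basis e := the_basisP Hsep.

Variables (I J : finType) (p : I -> Hm) (q : J -> Hm).
Hypotheses (kerp : forall i, ker_op M (p i)) (kerq : forall i, ker_op N (q i)).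
Hypothesis pker : forall x, ker_op M x -> x = \sum_i inner x (p i) *: p i.
Hypothesis qker : forall x, ker_op N x -> x = \sum_i inner x (q i) *: q i.

Variables (T Sstar : H -> H).
Hypotheses (Tl : linear T) (Tc : continuous T).
Hypotheses (Sl : linear Sstar) (Sc : continuous Sstar).

Variable delta : R.
Hypothesis delta0 : 0 < delta.
Hypothesis reg1 : forall z : R[i], 0 < rn z < delta -> regular (comp_op N M) z.
Hypothesis reg2 : forall z : R[i], 0 < rn z < delta -> regular (comp_op M N) z.

Let K z := T \o B_op M z \o adj Sstar.

Let phi (k : nat) (j : 'I_m) (x : Hm) : R[i] := inner (T (x j)) (e k).
Let u (k : nat) (j : 'I_m) : Hm := iota_hpow j (adj Sstar (e k)).

(** The diagonal entries of T B_M(z) S are sums of bounded functionals of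
    z (M* M + z)^-1 and z (M M* + z)^-1. *)
Lemma diagonal_decomposition z k : inner (K z (e k)) (e k) =
  \sum_j (phi k j (scaled_res (comp_op N M) z (u k j)) - phi k j (scaled_res (comp_op M N) z (u k j))).
Proof.
rewrite /K /= /B_op /internal_trace scaler_sumr (lin_sum _ _ _ Tl) inner_suml.
apply: eq_bigr => j _; rewrite /phi -innerBl -(linB Tl) /block /scaled_res.
by rewrite !ffunE scalerBr.
Qed.

Let phi_linear k j : linear (phi k j).
Proof. by move=> a x y; rewrite /phi !ffunE Tl inner_linearl. Qed.

(** The trace of T tr_m(P - Q) S, where P and Q are the orthogonal projections on
    ker M and ker M*, after summing over the basis. *)
Definition limit_trace : R[i] :=
  \sum_j (\sum_i inner (T (p i j)) (Sstar (p i j)) -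
          \sum_i inner (T (q i j)) (Sstar (q i j))).

Let diag0 k : R[i] := \sum_j (phi k j (ker_proj p (u k j)) - phi k j (ker_proj q (u k j))).

Let phi_proj (I' : finType) (p' : I' -> Hm) k j : phi k j (ker_proj p' (u k j)) =
  \sum_i inner (T (p' i j)) (e k) * inner (e k) (Sstar (p' i j)).
Proof.
rewrite /ker_proj (lin_sum _ _ _ (phi_linear k j)); apply: eq_bigr => i _.
rewrite (linZ (phi_linear k j)) /u inner_iota_hpow mulrC; congr (_ * _).
by rewrite inner_conj -(adjP eb)// -inner_conj.
Qed.

(** Parseval, as P and Q have finite rank. *)
Lemma diag0_cvg : (\sum_(k < n) diag0 k) @[n --> \oo] --> limit_trace.
Proof.
rewrite (_ : (fun n => _) = fun n => \sum_j (
    \sum_i \sum_(k < n) inner (T (p i j)) (e k) * inner (e k) (Sstar (p i j)) -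
    \sum_i \sum_(k < n) inner (T (q i j)) (e k) * inner (e k) (Sstar (q i j)))); last first.
  apply/funext => n; rewrite exchange_big /=; apply: eq_bigr => j _.
  rewrite sumrB; congr (_ - _); rewrite exchange_big /=;
  by apply: eq_bigr => k _; rewrite phi_proj.
apply: cvg_finsum => j; apply: cvgB; apply: cvg_finsum => i; exact: (@Parseval _ _ _ eb).
Qed.

Lemma diagonal_expansion k : exists a D, [/\ 0 <= D, a 0%N = diag0 k &
  geometric_expansion (fun z => inner (K z (e k)) (e k)) a D (2 / delta) (delta / 4)].
Proof.
have [C C0 TC] := continuous_bounded Tl (@Tc 0).
have phiC j x : rn (phi k j x) <= C * rn x.
  rewrite (le_trans (inner_CauchySchwarz _ _))// -[leRHS]mulr1.
  rewrite ler_pM ?rn_ge0 ?rn_basis_le1// (le_trans (TC _))// ler_wpM2l//.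
  by rewrite -lecR -!rnE norm_hpow_coord.
have Nl := adjoint_linear Md.
have l1 : linear_op (comp_op N M) by exact: comp_linear.
have l2 : linear_op (comp_op M N) by exact: comp_linear.
have k1 i : ker_op (comp_op N M) (p i) by rewrite ker_adjoint_comp.
have k2 i : ker_op (comp_op M N) (q i) by rewrite ker_comp_adjoint.
have [|G1 hG1] := resolvent_expansion l1 (adjoint_comp_symmetric (M := M))
   (adjoint_comp_ge0 (M := M)) delta0 reg1 k1.
  by move=> x; rewrite ker_adjoint_comp//; exact: pker.
have [|G2 hG2] := resolvent_expansion l2 (comp_adjoint_symmetric (M := M))
   (comp_adjoint_ge0 (M := M)) delta0 reg2 k2.
  by move=> x; rewrite ker_comp_adjoint//; exact: qker.
have e1 j := hG1 _ _ (u k j) (phi_linear k j) (phiC j) C0.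
have e2 j := hG2 _ _ (u k j) (phi_linear k j) (phiC j) C0.
have h := geometric_expansion_sum (index_enum 'I_m) (fun j =>
  geometric_expansionD (e1 j) (geometric_expansionN (e2 j))).
eexists; eexists; split; last first.
- by move=> n z zr; rewrite diagonal_decomposition; exact: h.
- by [].
- by apply: sumr_ge0 => j _; rewrite addr_ge0// mulr_ge0 ?rn_ge0.
Qed.

Variable C : R.
Hypothesis Ktc : forall z : R[i], 0 < rn z < delta -> trace_class (K z).
Hypothesis KC : forall z : R[i], 0 < rn z < delta -> (trace_norm (K z) <= C%:E)%E.

(** Only the partial sums of the trace norm are used. *)
Lemma diagonal_bound (z : R[i]) n : 0 < rn z < delta ->
  \sum_(k < n) rn (inner (K z (e k)) (e k)) <= C.
Proof.
move=> zd; have [Kl Kc _] := Ktc zd.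
apply: (diagonal_le_trace eb) => // n'.
have [_ _ A0 _] := absopP eb Kl Kc.
rewrite -lee_fin (le_trans _ (KC zd))// /trace_norm.
rewrite -sumEFin -(big_mkord xpredT
  (fun k => (complex.Re (inner (absop (K z) (e k)) (e k)))%:E)).
by apply: nneseries_lim_ge => k _ _; rewrite lee_fin Re_ge0.
Qed.

(** The partial sums of the diagonal have expansions whose remainders degenerate as
    n grows, but they share the bound C; so the Schwarz estimate is uniform in n. *)
Lemma trace_estimate (z : R[i]) : 0 < rn z <= delta / 8 ->
  rn (trace (K z) - limit_trace) <= 2 * C / (delta / 4) * rn z.
Proof.
move=> /andP[z0 z8].
have small (w : R[i]) : 0 < rn w <= delta / 4 -> 0 < rn w < delta.
  by move=> /andP[-> h] /=; rewrite (le_lt_trans h)//; have := delta0; lra.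
have z4 : 0 < rn z <= delta / 4 by rewrite z0 (le_trans z8)//; have := delta0; lra.
have hS : series (fun k => inner (K z (e k)) (e k)) @ \oo --> trace (K z).
  by apply: (@absolute_cvg _ _ C) => n; exact: diagonal_bound (small _ z4).
have [a ha] := choice diagonal_expansion; have {ha}[D ha] := choice ha.
apply: (cvg_rn_le hS diag0_cvg); near=> n.
rewrite seriesEord /=.
have := @Schwarz_estimate R (fun z => \sum_(k < n) inner (K z (e k)) (e k))
  (fun j => \sum_(k < n) a k j) (\sum_(k < n) D k) (2 / delta) (delta / 4) C.
have -> : \sum_(k < n) a k 0%N = \sum_(k < n) diag0 k.
  by apply: eq_bigr => k _; have [] := ha k.
apply.
- by apply: sumr_ge0 => k _; have [] := ha k.
- by rewrite divr_ge0// ltW.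
- by rewrite divr_gt0.
- by rewrite le_eqVlt; apply/orP; left; apply/eqP; field; rewrite gt_eqF.
- by apply: geometric_expansion_sum => k; have [] := ha k.
- move=> w wd; rewrite (le_trans (rn_sum _ _ _))// diagonal_bound//.
  exact: small.
- by rewrite z0 /= (le_trans z8)//; have := delta0; lra.
Unshelve. all: by end_near. Qed.

End WittenIndex.

Lemma ker_op_linear (R : realType) (V : hilbertType R) (A : partial_op V V) :
  linear_op A -> ker_op A 0 /\
  forall a x y, ker_op A x -> ker_op A y -> ker_op A (a *: x + y).
Proof.
move=> Al; split=> [|a x y [dx Ax] [dy Ay]].
  by split; [exact: opl_dom0|exact: opl0].
by split; [exact: opl_dom|rewrite oplE// Ax Ay scaler0 addr0].
Qed.

Lemma uniform_on_cvg (R : realType) (B : set R[i]) (f : nat -> R[i] -> R[i]) (F : R[i] -> R[i]) :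
  {uniform B, f @ \oo --> F} -> forall d : R, 0 < d ->
  \forall n \near \oo, forall z, B z -> rn (F z - f n z) < d.
Proof.
move=> h d d0.
have := h [set g | forall z, B z -> rn (F z - g z) < d]; apply.
apply/uniform_nbhs; exists [set xy | ball xy.1 d%:C xy.2]; split.
  by rewrite -entourage_ballE; exists d%:C => //=; rewrite ltcR.
move=> g hg z Bz; have := hg z Bz; rewrite /= -ball_normE /=.
by rewrite rnE ltcR.
Qed.

Theorem theorem1p2 (R : realType) (H : hilbertType R) (m : nat)
    (M : partial_op (hpow H m) (hpow H m))
    (T Sstar : nat -> {linear H -> H}) (delta : nat -> R) :
  let S n := adj (Sstar n) in
  let Omega n := [set z : R[i] | 0 < `|z| < (delta n)%:C] in
  let K n z := T n \o B_op M z \o S n in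
  let tau n z := trace (K n z) in
  separable H ->
  linear_op M -> dense (dom M) -> closed_op M -> Fredholm M ->
  (forall n, continuous (T n)) -> (forall n, continuous (Sstar n)) ->
  strong_cvg T idfun -> strong_cvg Sstar idfun ->
  (forall n, 0 < delta n) ->
  (forall n, Omega n `<=` resolvent_set (opp_op (comp_op M (adjoint M)))
                      `&` resolvent_set (opp_op (comp_op (adjoint M) M))) ->
  (forall n z, Omega n z -> trace_class (K n z)) ->
  (forall n, exists C : R, forall z, Omega n z ->
    (trace_norm (K n z) <= C%:E)%E) ->
  [/\ forall n, cvg (tau n z @[z --> 0^']),
      lim (tau n z @[z --> 0^']) @[n --> \oo] --> ((fredholm_index M)%:~R : R[i]) &
      forall F : R[i] -> R[i],
        let d := 2^-1 * inf (range delta) in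
        let tau0 n z := if z == 0 then lim (tau n w @[w --> 0^']) else tau n z in
        0 < d ->
        {uniform [set z : R[i] | `|z| <= d%:C], tau0 @ \oo --> F} ->
        [/\ \forall z \near 0^', cvg (tau n z @[n --> \oo]),
            lim (tau n z @[n --> \oo]) @[z --> 0^'] --> ((fredholm_index M)%:~R : R[i]) &
            F 0 = (fredholm_index M)%:~R]].
Proof.
move=> S Omega K tau Hsep Ml Md Mc [_ fk fk'] Tc Sc Ts Ss d0 hres htc hC.
have Nl := adjoint_linear Md.
have [kM0 kMl] := ker_op_linear Ml; have [kN0 kNl] := ker_op_linear Nl.
have [p [pk p1 pE]] := orthonormal_basis_exists kM0 kMl fk.
have [q [qk q1 qE]] := orthonormal_basis_exists kN0 kNl fk'.
have Tl n : linear (T n) by exact: linearP.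
have Sl n : linear (Sstar n) by exact: linearP.
have OmegaE n z : Omega n z = (0 < rn z < delta n).
  by rewrite /Omega /= rnE !ltcR.
pose t0 n := limit_trace p q (T n) (Sstar n).
have est n : exists C, forall z : R[i], 0 < rn z <= delta n / 8 ->
    rn (tau n z - t0 n) <= C * rn z.
  have [C hCn] := hC n; exists (2 * C / (delta n / 4)) => z zr.
  apply: (trace_estimate Hsep Ml Md pk qk pE qE) => //.
  - move=> w wd; apply: (resolvent_regular (comp_linear Nl Ml)).
    have Ow : Omega n w by rewrite OmegaE.
    by have [] := hres n w Ow.
  - move=> w wd; apply: (resolvent_regular (comp_linear Ml Nl)).
    have Ow : Omega n w by rewrite OmegaE.
    by have [] := hres n w Ow.
  - by move=> w wd; apply: htc; rewrite OmegaE.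
  - by move=> w wd; apply: hCn; rewrite OmegaE.
have d80 n : 0 < delta n / 8 by rewrite divr_gt0.
have tau_cvg n : tau n z @[z --> 0^'] --> t0 n.
  have [C hCn] := est n; exact: (cvg_at0 (d80 n) hCn).
have limE n : lim (tau n z @[z --> 0^']) = t0 n.
  exact: (cvg_lim (@norm_hausdorff _ _) (tau_cvg n)).
have t0_cvg : t0 n @[n --> \oo] --> ((fredholm_index M)%:~R : R[i]).
  have -> : (fredholm_index M)%:~R =
      \sum_j (\sum_i inner (p i j) (p i j) - \sum_i inner (q i j) (q i j)) :> R[i].
    rewrite sumrB [X in X - _]exchange_big [X in _ - X]exchange_big /=.
    rewrite (eq_bigr (fun=> 1)) => [|i _]; last by rewrite -hpow_innerE p1.
    rewrite [X in _ - X](eq_bigr (fun=> 1)) => [|i _]; last by rewrite -hpow_innerE q1.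
    by rewrite !sumr_const !card_ord /fredholm_index rmorphB.
  apply: cvg_finsum => j; apply: cvgB; apply: cvg_finsum => i; apply: cvg_inner.
  - exact: Ts.
  - exact: Ss.
  - exact: Ts.
  - exact: Ss.
split.
- by move=> n; apply/cvg_ex; exists (t0 n); exact: tau_cvg.
- have -> : (fun n => lim (tau n z @[z --> 0^'])) = t0 by apply/funext => n; exact: limE.
  exact: t0_cvg.
move=> F d tau0' dp unif.
have tau0'0 n : tau0' n 0 = t0 n by rewrite /tau0' eqxx limE.
have Fu := uniform_on_cvg unif.
have F_cvg z : `|z| <= d%:C -> tau0' n z @[n --> \oo] --> F z.
  move=> zd; apply/cvg_rnP => a a0; have := Fu a a0; apply: filterS => n h.
  exact: h.
have F0 : F 0 = (fredholm_index M)%:~R.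
  have := F_cvg 0; rewrite normr0 ler0c ltW// => /(_ isT) h.
  have E : (fun n => tau0' n 0) = t0 by apply/funext => n; exact: tau0'0.
  by rewrite E in h; exact: (rn_cvg_unique h t0_cvg).
have tauF z : z != 0 -> `|z| <= d%:C -> tau n z @[n --> \oo] --> F z.
  move=> z0 zd; have h := F_cvg z zd.
  have E : (fun n => tau0' n z) = tau^~ z.
    by apply/funext => n; rewrite /tau0' (negPf z0).
  by rewrite E in h.
have near_d : \forall z \near (0 : R[i])^', z != 0 /\ `|z| <= d%:C.
  apply: filterS (dnbhs0_small dp) => z [z0 zd]; split=> //.
  by rewrite rnE lecR ltW.
split=> //.
- apply: filterS near_d => z [z0 zd]; apply/cvg_ex; exists (F z); exact: tauF.
(* interchange: F z, tau n z, t0 n and F 0 are successively close, for one n that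
   is uniform in z *)
- rewrite -F0; apply/cvg_rnP => a a0.
  have a3 : 0 < a / 3 by rewrite divr_gt0.
  have [n hn] := filter_ex (Fu _ a3).
  have /cvg_rnP/(_ _ a3) := tau_cvg n.
  move: near_d; apply: filterS2 => z [z0 zd] h.
  rewrite (cvg_lim (@norm_hausdorff _ _) (tauF z z0 zd)).
  have h1 := hn z zd; have := hn 0; rewrite /= normr0 ler0c ltW// => /(_ isT).
  rewrite tau0'0 => h2; rewrite /tau0' (negPf z0) in h1.
  have := rnB_trans (t0 n) (F 0) (F z); have := rnB_trans (tau n z) (t0 n) (F z).
  rewrite (rn_distC (tau n z)); lra.
Qed.
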